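(* Let $A$ and $B$ be unital complex Banach algebras such that $A$ is a subalgebra of $B$ and the unit of $B$ lies in $A$. Assume that $A$ is a symmetric Banach *-algebra, that $A$ is *-inverse closed in $B$, and that $A$ is continuously embedded in $B$. Let $n\ge 1$. Then $M_n(A)$ is symmetric and *-inverse closed in $M_n(B)$.
   Context: $A$ and $B$ carry their own complete Banach algebra norms $\|\cdot\|_A$, $\|\cdot\|_B$; $B$ is not assumed to have an involution. A Banach *-algebra is a Banach algebra with an involution $*$. A unital Banach *-algebra $A$ with unit $1$ is symmetric if $1+a^*a$ is invertible in $A$ for all $a\in A$. $A$ is continuously embedded in $B$ if there exists $J>0$ such that $J\|a\|_A\ge\|a\|_B$ for all $a\in A$. For a unital *-algebra $C$ that is a subalgebra of an algebra $D$ and contains the unit of $D$, $C$ is *-inverse closed in $D$ if whenever $c=c^*\in C$ is invertible in $D$, then $c^{-1}\in C$. $M_n(D)$ denotes the algebra of all $n\times n$ matrices with entries from $D$; for a Banach algebra $D$ it is a Banach algebra under the norm $\|(t_{jk})\|=\sum_{j,k}\|t_{jk}\|_D$ (or any equivalent norm). $M_n(A)$ carries the involution $(t_{jk})^*=(t_{kj}^* )$. *)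

(* Defs.v *)
From HB Require Import structures.
From mathcomp Require Import all_boot all_order all_algebra.
From mathcomp Require Import complex.
From mathcomp Require Import all_classical all_reals topology normedtype.

Set Implicit Arguments.
Unset Strict Implicit.
Unset Printing Implicit Defensive.

Import Order.TTheory GRing.Theory Num.Theory.
Import numFieldNormedType.Exports.

Local Open Scope classical_set_scope.
Local Open Scope ring_scope.

(* The norm is not Num.norm on A itself, because Hierarchy Builder admits no
   common extension of normed modules and rings: such an extension and
   numDomainType (whose norm takes values in the ring itself) would both inherit
   from SemiNormedZmodule and PzSemiRing without a common ancestor.
   It takes its values in K (for K = R[i], in the nonnegative reals) and is only
   required to be submultiplicative: anorm 1 = 1 is not assumed, which allows
   the norm \sum_(j, k) anorm (t j k) on matrices. *)
HB.mixin Record Algebra_isNormed (K : numFieldType) A & GRing.Algebra K A := {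
  anorm : A -> K;
  anormD : forall x y : A, anorm (x + y) <= anorm x + anorm y;
  anormZ : forall (k : K) (x : A), anorm (k *: x) = `|k| * anorm x;
  anorm0_eq0 : forall x : A, anorm x = 0 -> x = 0;
  anormM : forall x y : A, anorm (x * y) <= anorm x * anorm y
}.

#[short(type="normedAlgType")]
HB.structure Definition NormedAlgebra (K : numFieldType) :=
  {A of GRing.Algebra K A & Algebra_isNormed K A}.

(* The normed module underlying a normed algebra; here `|x| is anorm x. *)
Definition normed_space (K : numFieldType) (A : normedAlgType K) : Type := A.

Section NormedSpace.
Variables (K : numFieldType) (A : normedAlgType K).
HB.instance Definition _ := GRing.Lmodule.on (normed_space A).
HB.instance Definition _ := Lmodule_isNormed.Build K (normed_space A)
  (@anormD K A) (@anormZ K A) (@anorm0_eq0 K A).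
End NormedSpace.

HB.mixin Record NormedAlgebra_isComplete (K : numFieldType) A
    & NormedAlgebra K A := {
  anorm_complete : forall F : set_system (normed_space A),
    ProperFilter F -> cauchy F -> cvg F
}.

#[short(type="banachAlgType")]
HB.structure Definition BanachAlgebra (K : numFieldType) :=
  {A of NormedAlgebra K A & NormedAlgebra_isComplete K A}.

HB.instance Definition _ (K : numFieldType) (A : banachAlgType K) :=
  Uniform_isComplete.Build (normed_space A) (@anorm_complete K A).

(* The ring part of an involution is separated from its conjugate-linearity:
   in MathComp 'M[A]_n carries its ring structure, but its scalars are those of
   A rather than those of the ground field of A. *)
HB.mixin Record PzRing_hasStar A & GRing.PzRing A := {
  star : A -> A;
  starK : involutive star;
  starD : {morph star : x y / x + y};
  starM : forall x y : A, star (x * y) = star y * star x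
}.

#[short(type="starRingType")]
HB.structure Definition StarRing := {A of GRing.PzRing A & PzRing_hasStar A}.

HB.mixin Record StarRing_isConjLinear (K : numClosedFieldType) A
    & StarRing A & GRing.Lmodule K A := {
  starZ : forall (k : K) (x : A), star (k *: x) = Num.conj k *: star x
}.

(* No compatibility between the involution and the norm (such as continuity of
   star, or anorm (star x) = anorm x) is required. *)
#[short(type="banachStarAlgType")]
HB.structure Definition BanachStarAlgebra (K : numClosedFieldType) :=
  {A of BanachAlgebra K A & StarRing A & StarRing_isConjLinear K A}.

Section MatrixStar.
Variables (A : starRingType) (n : nat).

Definition star_mx (M : 'M[A]_n) : 'M[A]_n := \matrix_(j, k) star (M k j).

Lemma star0 : star (0 : A) = 0.
Proof. by apply: (addrI (star (0 : A))); rewrite -starD !addr0. Qed.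

Lemma star_mxK : involutive star_mx.
Proof. by move=> M; apply/matrixP => j k; rewrite !mxE starK. Qed.

Lemma star_mxD : {morph star_mx : M N / M + N}.
Proof. by move=> M N; apply/matrixP => j k; rewrite !mxE starD. Qed.

Lemma star_mxM (M N : 'M[A]_n) : star_mx (M * N) = star_mx N * star_mx M.
Proof.
apply/matrixP => j k; rewrite !mxE (big_morph _ (@starD A) star0).
by apply: eq_bigr => i _; rewrite !mxE starM.
Qed.

HB.instance Definition _ :=
  PzRing_hasStar.Build 'M[A]_n star_mxK star_mxD star_mxM.
End MatrixStar.

(* MathComp's boolean GRing.unit is only available on rings with a declared
   inverse operation, which matrices over a noncommutative ring do not have. *)
Definition is_inverse (D : pzRingType) (x y : D) := x * y = 1 /\ y * x = 1.

Definition invertible (D : pzRingType) (x : D) := exists y, is_inverse x y.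

Definition star_symmetric (A : starRingType) :=
  forall a : A, invertible (1 + star a * a).

(* C is regarded as a subring of D through the (injective) unital morphism f. *)
Definition star_inverse_closed (C : starRingType) (D : pzRingType)
    (f : {rmorphism C -> D}) :=
  forall c : C, star c = c ->
  forall d : D, is_inverse (f c) d -> exists c' : C, f c' = d.

Definition continuously_embedded (R : realType) (A B : banachAlgType R[i])
    (f : A -> B) :=
  exists2 J : R, 0 < J & forall a : A, real_complex R J * anorm a >= anorm (f a).

(* Main.v *)
Require Import Defs.
From HB Require Import structures.
From mathcomp Require Import all_boot all_order all_algebra.
From mathcomp Require Import complex.
From mathcomp Require Import all_classical all_reals topology normedtype.
From mathcomp Require Import ring lra.

Set Implicit Arguments.
Unset Strict Implicit.
Unset Printing Implicit Defensive.

Import Order.TTheory GRing.Theory Num.Theory.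
Import numFieldNormedType.Exports.
Import Normc.

Local Open Scope classical_set_scope.
Local Open Scope ring_scope.

(** The proof rests on square roots.  In a symmetric Banach *-algebra [A] a
    self-adjoint element has real spectrum, and one whose spectrum lies in the
    open positive half-line is the square of a self-adjoint element
    ([sqrt_positive]).

    Symmetry of [M_n(A)].  If [p] is [1] plus a finite sum of squares [t^* t] and
    [p = w ^ 2] with [w] self-adjoint, then
    [p + y^* y = w (1 + (y w^-1)^* (y w^-1)) w] is invertible; by induction, so is
    [1] plus any finite sum of squares ([sum_squares_invertible]).  Taking Schur
    complements, this extends to [1 + T^* T] for every rectangular matrix [T] over
    [A] ([gram_mx_invertible]), by induction on the number of columns.

    Inverse closedness.  Let [c] be self-adjoint in [M_n(A)] and invertible in
    [M_n(B)].  By symmetry the spectrum of [c ^ 2] in [M_n(A)] is real and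
    nonnegative, and [0] is not in its spectrum in [M_n(B)]; so
    [K = 1 - c ^ 2 / e], with [e] large, has spectral radius less than [1] in
    [M_n(B)], and some power [H = K ^ N] has entries small in [B].  If [h] is an
    entry of [H], so is [h^*], and [h^* h] is small in [B]; since [A] is *-inverse
    closed in [B], the spectrum of [h^* h] in [A] contains no number
    [r >= eps ^ 2], and [eps ^ 2 - h^* h] has a square root in [A]
    ([sqrt_scal_sub]).  Completing squares in the entries writes [n eps - H] as a
    positive multiple of a matrix [T^* T], so that [1 - H] is invertible in
    [M_n(A)] when [n eps < 1] ([invertible_sub1_small]), and with it its factor
    [1 - K], which is [c ^ 2 / e].

    The square root is obtained from the spectral radius formula
    ([spectral_geometric_powers]): if [1 - k x] is invertible for all [k] in the
    closed unit disc, then the powers of [x] decay geometrically.  The proof of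
    the latter uses no holomorphic functions but averages of the resolvent over
    roots of unity.  As the involution may be discontinuous, that the square root
    is self-adjoint follows from a uniqueness argument
    ([sqrt_sub1_self_adjoint]). *)

(** * Inverses in noncommutative rings *)

Section Inverses.
Variable D : pzRingType.
Implicit Types x y z : D.

Lemma left_right_inverse x y z : y * x = 1 -> x * z = 1 -> is_inverse x z.
Proof.
move=> yx xz; split=> //; suff <- : y = z by [].
by rewrite -[y]mulr1 -xz mulrA yx mul1r.
Qed.

Lemma is_inverse_uniq x y z : is_inverse x y -> is_inverse x z -> y = z.
Proof. by move=> [_ yx] [xz _]; rewrite -[y]mulr1 -xz mulrA yx mul1r. Qed.

Lemma is_inverseM x y x' y' :
  is_inverse x x' -> is_inverse y y' -> is_inverse (x * y) (y' * x').
Proof.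
move=> [xx' x'x] [yy' y'y]; split.
  by rewrite mulrA -(mulrA x) yy' mulr1.
by rewrite mulrA -(mulrA y') x'x mulr1.
Qed.

Lemma invertibleM x y : invertible x -> invertible y -> invertible (x * y).
Proof. by move=> [x' hx] [y' hy]; exists (y' * x'); exact: is_inverseM. Qed.

Lemma invertible_comm_factor x y :
  GRing.comm x y -> invertible (x * y) -> invertible x.
Proof.
move=> xy [z [xyz zxy]]; exists (y * z).
apply: (@left_right_inverse _ (z * y)); last by rewrite mulrA.
by rewrite -mulrA -xy.
Qed.

Lemma comm_inverse x y z : is_inverse x y -> GRing.comm z x -> GRing.comm z y.
Proof.
move=> [xy yx] zx; rewrite /GRing.comm -[LHS]mul1r -yx -mulrA (mulrA x) -zx.
by rewrite -(mulrA z) xy mulr1.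
Qed.

(** [1 - x] divides [1 - x ^+ n]. *)
Lemma invertible_sub1_expr x n : invertible (1 - x ^+ n) -> invertible (1 - x).
Proof.
rewrite -opprB subrX1 -mulNr opprB; apply: invertible_comm_factor.
apply: commr_sum => i _; apply: commrX; apply: commr_sym.
exact: commrB (commr1 _) (commr_refl _).
Qed.

End Inverses.

Lemma is_inverse_morph (C D : pzRingType) (f : {rmorphism C -> D}) x y :
  is_inverse x y -> is_inverse (f x) (f y).
Proof. by move=> [xy yx]; split; rewrite -rmorphM ?xy ?yx rmorph1. Qed.

Lemma invertible_morph (C D : pzRingType) (f : {rmorphism C -> D}) x :
  invertible x -> invertible (f x).
Proof. by move=> [y xy]; exists (f y); exact: is_inverse_morph. Qed.

Lemma invertible_field (K : fieldType) (D : pzRingType) (f : {rmorphism K -> D})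
  (k : K) : k != 0 -> invertible (f k).
Proof.
move=> k0; apply: invertible_morph; exists k^-1.
by split; [exact: divff | exact: mulVf].
Qed.

(** * Complete normed algebras over the complex numbers *)

Lemma bernoulli_expr (R : realType) (x : R) n :
  - 1 <= x -> 1 + n%:R * x <= (1 + x) ^+ n.
Proof.
move=> x1; elim: n => [|n IH]; first by rewrite mul0r addr0 expr0.
have nge0 : (0 : R) <= n%:R by exact: ler0n.
have x2 : 0 <= x ^+ 2 by exact: sqr_ge0.
rewrite exprS -natr1; apply: le_trans (ler_wpM2l _ IH); last by lra.
nra.
Qed.

Lemma expr_unbounded (R : realType) (x a : R) :
  0 < x -> exists N, forall n, (N <= n)%N -> a < (1 + x) ^+ n.
Proof.
move=> x0; have [N aN] : exists N : nat, a / x < N%:R.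
  by exists (Num.truncn (a / x)).+1; exact: truncnS_gt.
exists N => n Nn.
have nge0 : (N%:R : R) <= n%:R by rewrite ler_nat.
apply: lt_le_trans (bernoulli_expr n _); last by lra.
have: a < N%:R * x by rewrite -ltr_pdivrMr.
nra.
Qed.

Lemma expr_small (R : realType) (q e : R) : 0 <= q < 1 -> 0 < e ->
  exists N, forall n, (N <= n)%N -> q ^+ n < e.
Proof.
move=> /andP[q0 q1] e0.
have [->|qn0] := eqVneq q 0.
  by exists 1 => -[|n] // _; rewrite expr0n.
have qp : 0 < q by rewrite lt0r qn0.
have q'p : 0 < q^-1 - 1 by rewrite subr_gt0 invf_gt1.
have [N HN] := expr_unbounded e^-1 q'p; exists N => n /HN.
by rewrite subrKC exprVn ltf_pV2 ?posrE ?exprn_gt0.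
Qed.

Lemma geometric_le0 (R : realType) (a C q : R) :
  0 <= q < 1 -> (forall n, a <= C * q ^+ n) -> a <= 0.
Proof.
move=> q01 H; rewrite leNgt; apply/negP => a0.
have Cp : 0 < C by have := H 0; rewrite expr0 mulr1; apply: lt_le_trans.
have [N /(_ N (leqnn N))] := expr_small q01 (divr_gt0 a0 Cp).
by rewrite ltr_pdivlMr // mulrC => /(le_lt_trans (H N)); rewrite ltxx.
Qed.

Lemma normc_ge0 (R : realType) (k : R[i]) : 0 <= normc k.
Proof. by case: k => a b; exact: sqrtr_ge0. Qed.

Lemma normc_gt0 (R : realType) (k : R[i]) : k != 0 -> 0 < normc k.
Proof.
move=> k0; rewrite lt0r normc_ge0 andbT.
by apply: contraNneq k0 => /eq0_normc ->.
Qed.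

(** The scalars enter as a central ring morphism rather than through an algebra
    structure, so that the same record describes both a Banach algebra [B] and
    the matrix ring over it, whose scalars in the library are those of [B].
    Completeness is only required for sequences whose increments are dominated
    by a geometric sequence. *)
Record banach_ring (R : realType) (D : pzRingType) := BanachRing {
  scal : {rmorphism R[i] -> D};
  scal_comm : forall k x, scal k * x = x * scal k;
  nrm : D -> R;
  nrm_ge0 : forall x, 0 <= nrm x;
  nrm0_eq0 : forall x, nrm x = 0 -> x = 0;
  nrmD : forall x y, nrm (x + y) <= nrm x + nrm y;
  nrmM : forall x y, nrm (x * y) <= nrm x * nrm y;
  nrm_scal : forall k x, nrm (scal k * x) = normc k * nrm x;
  nrm_complete : forall (f : nat -> D) (C q : R), 0 <= q < 1 ->
    (forall n, nrm (f n.+1 - f n) <= C * q ^+ n) ->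
    exists l C', forall n, nrm (l - f n) <= C' * q ^+ n
}.

Section BanachRing.
Variables (R : realType) (D : pzRingType) (S : banach_ring R D).
Implicit Types (x y z : D) (k : R[i]) (r : R).
Local Notation sc := (scal S).
Local Notation "`[ x ]" := (nrm S x) (at level 0, x at level 99).

Lemma normc_real r : normc r%:C%C = `|r|.
Proof. by rewrite /= expr0n addr0 sqrtr_sqr. Qed.

Lemma nrm0 : `[0] = 0.
Proof. by rewrite -[0](mul0r 0) -(rmorph0 sc) nrm_scal normc0 mul0r. Qed.

Lemma nrmN x : `[- x] = `[x].
Proof.
have -> : - x = sc (-1) * x by rewrite rmorphN1 mulN1r.
by rewrite nrm_scal -(rmorphN1 (real_complex R)) normc_real normrN1 mul1r.
Qed.

Lemma nrmB x y : `[x - y] <= `[x] + `[y].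
Proof. by rewrite -(nrmN y); exact: nrmD. Qed.

Lemma nrm_eq0 x : `[x] <= 0 -> x = 0.
Proof.
by move=> x0; apply: (@nrm0_eq0 _ _ S); apply/le_anti; rewrite x0 nrm_ge0.
Qed.

Lemma nrm_geometric_eq0 x C q :
  0 <= q < 1 -> (forall n, `[x] <= C * q ^+ n) -> x = 0.
Proof. by move=> q01 /(geometric_le0 q01)/nrm_eq0. Qed.

Lemma nrm_exp x n : `[x ^+ n] <= `[1] * `[x] ^+ n.
Proof.
elim: n => [|n IH]; first by rewrite !expr0 mulr1.
rewrite exprSr (le_trans (nrmM _ _ _)) // exprSr mulrA.
by rewrite ler_wpM2r ?nrm_ge0.
Qed.

Lemma nrm_inverse_le x y : `[x] < 1 -> is_inverse (1 - x) y ->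
  `[y] <= `[1] / (1 - `[x]).
Proof.
move=> x1 [xy _]; rewrite ler_pdivlMr ?subr_gt0 //.
have -> : `[1] = `[y - x * y] by rewrite -xy mulrBl mul1r.
have := nrmM S x y; have := nrmD S (y - x * y) (x * y); rewrite subrK; nra.
Qed.

(** The geometric series. *)
Lemma neumann x : `[x] < 1 -> invertible (1 - x).
Proof.
move=> x1; have q01 : 0 <= `[x] < 1 by rewrite nrm_ge0.
pose s n := \sum_(i < n) x ^+ i.
have [l [C Hl]] : exists l C, forall n, `[l - s n] <= C * `[x] ^+ n.
  apply: (nrm_complete (C := `[1])) => // n.
  by rewrite /s big_ord_recr /= addrAC subrr add0r nrm_exp.
have sx n : (1 - x) * s n = 1 - x ^+ n.
  by rewrite -[RHS]opprB subrX1 -mulNr opprB.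
have xs n : s n * (1 - x) = 1 - x ^+ n.
  rewrite -sx; apply: commr_sym; apply: commr_sum => i _; apply: commrX.
  by apply: commr_sym; apply: commrB; [exact: commr1|exact: commr_refl].
exists l; split; apply/subr0_eq;
  apply: (@nrm_geometric_eq0 _ (`[1 - x] * C + `[1]) _ q01) => n.
- have -> : (1 - x) * l - 1 = (1 - x) * (l - s n) - x ^+ n.
    by rewrite (mulrBr _ l) sx opprB addrAC addrA subrK addrC.
  apply: le_trans (nrmB _ _) _; rewrite [leRHS]mulrDl lerD ?nrm_exp //.
  by rewrite (le_trans (nrmM _ _ _)) // -mulrA ler_wpM2l ?nrm_ge0.
- have -> : l * (1 - x) - 1 = (l - s n) * (1 - x) - x ^+ n.
    by rewrite (mulrBl _ l) xs opprB addrAC addrA subrK addrC.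
  apply: le_trans (nrmB _ _) _; rewrite [leRHS]mulrDl lerD ?nrm_exp //.
  rewrite (le_trans (nrmM _ _ _)) // mulrC -mulrA.
  by rewrite ler_wpM2l ?nrm_ge0.
Qed.

Lemma neumann_scal x k : `[x] < normc k -> invertible (sc k - x).
Proof.
move=> xk; have kp : 0 < normc k by rewrite (le_lt_trans (nrm_ge0 S x)).
have k0 : k != 0 by apply: contraTneq kp => ->; rewrite normc0 ltxx.
have -> : sc k - x = sc k * (1 - sc k^-1 * x).
  by rewrite mulrBr mulr1 mulrA -rmorphM divff // rmorph1 mul1r.
apply: invertibleM; first exact: invertible_field.
by apply: neumann; rewrite nrm_scal normcV mulrC ltr_pdivrMr ?mul1r.
Qed.

End BanachRing.

(** * Resolvents and the spectral radius *)

Section SpectralRadius.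
Variables (R : realType) (D : pzRingType) (S : banach_ring R D).
Implicit Types (x y z : D) (k : R[i]) (r : R).
Local Notation sc := (scal S).
Local Notation "`[ x ]" := (nrm S x) (at level 0, x at level 99).

Lemma resolvent_perturb x k k' y : is_inverse (1 - sc k * x) y ->
    normc (k' - k) * `[x] * `[y] <= 2^-1 ->
  exists2 y', is_inverse (1 - sc k' * x) y' & `[y'] <= 2 * `[1] * `[y].
Proof.
move=> hy kk'; set w := y * (sc (k' - k) * x).
have w12 : `[w] <= 2^-1.
  by rewrite (le_trans (nrmM _ _ _)) // nrm_scal mulrC.
have [|v hv] := @neumann _ _ S w; first by lra.
exists (v * y).
  have -> : 1 - sc k' * x = (1 - sc k * x) * (1 - w).
    rewrite mulrBr mulr1 /w mulrA (proj1 hy) mul1r rmorphB mulrBl opprB addrA.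
    by rewrite subrK.
  exact: is_inverseM.
apply: le_trans (nrmM _ _ _) _; apply: ler_wpM2r; first exact: nrm_ge0.
apply: le_trans (nrm_inverse_le _ hv) _; first by lra.
have n1 := nrm_ge0 S 1.
rewrite ler_pdivrMr; last by lra.
nra.
Qed.

Lemma normc_le_ReIm (a b : R) : normc (a +i* b)%C <= `|a| + `|b|.
Proof.
rewrite /= -(@ler_pXn2r _ 2) ?nnegrE ?sqrtr_ge0 ?addr_ge0 //.
rewrite sqr_sqrtr ?addr_ge0 ?sqr_ge0 // -[a ^+ 2]real_normK ?num_real //.
rewrite -[b ^+ 2]real_normK ?num_real //.
have := normr_ge0 a; have := normr_ge0 b; nra.
Qed.

(** The resolvent is locally bounded and the disc is compact. *)
Lemma resolvent_bounded x :
    (forall k, normc k <= 1 -> invertible (1 - sc k * x)) ->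
  exists L : R, forall k, normc k <= 1 ->
    exists2 y, is_inverse (1 - sc k * x) y & `[y] <= L.
Proof.
move=> inv_x.
pose disc := [set p : R * R | p.1 * p.1 + p.2 * p.2 <= 1].
have disc_compact : compact disc.
  apply: (subclosed_compact _
    (compact_setX (@segment_compact R (-1) 1) (@segment_compact R (-1) 1))).
    apply: (@closed_comp _ _ (fun p : R * R => p.1 * p.1 + p.2 * p.2)
              [set r : R | r <= 1]); last exact: closed_le.
    move=> p _; apply: cvgD; apply: cvgM;
      by [exact: cvg_fst | exact: cvg_snd].
  move=> [a b]; rewrite /disc /= => ab.
  by split; rewrite /= in_itv /=; apply/andP; split; nra.
have normc_disc (a b : R) : normc (a +i* b)%C <= 1 <-> disc (a, b).
  rewrite /disc /= -!expr2.
  rewrite -{1}(@sqrtr1 R) ler_psqrt ?nnegrE ?addr_ge0 ?sqr_ge0 //.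
have := (compact_near_coveringP disc).1 disc_compact nat \oo
  (fun n p => exists2 y, is_inverse (1 - sc (p.1 +i* p.2)%C * x) y
     & `[y] <= n%:R).
case=> [[a b] ab|N _ HN].
- have [y hy] := inv_x (a +i* b)%C ((normc_disc a b).2 ab).
  pose e := (4 * (`[x] * `[y] + 1))^-1.
  have xy0 : 0 <= `[x] * `[y] by rewrite mulr_ge0 ?nrm_ge0.
  have e0 : 0 < e by rewrite invr_gt0; lra.
  exists (ball (a, b) e, [set n : nat | 2 * `[1] * `[y] <= n%:R]).
    split; first exact: nbhsx_ballx.
    exists (Num.truncn (2 * `[1] * `[y])).+1 => // n /= Nn.
    apply: le_trans (ltW (truncnS_gt _)) _; by rewrite ler_nat.
  move=> [[a' b'] n] /= [[ha hb] yn].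
  have [|y' hy' y'le] := @resolvent_perturb x (a +i* b)%C (a' +i* b')%C y hy.
    rewrite -mulrA.
    have : normc ((a' +i* b') - (a +i* b))%C <= 2 * e.
      apply: le_trans (normc_le_ReIm _ _) _.
      move: ha hb; rewrite /ball /= !(distrC a) !(distrC b); lra.
    have : e * (4 * (`[x] * `[y] + 1)) = 1 by rewrite mulVf //; lra.
    nra.
  by exists y' => //; exact: le_trans y'le yn.
- exists N%:R => -[a b] /normc_disc kd.
  exact: (HN N (leqnn N) _ kd).
Qed.

(** [(1 - a ^+ 2)^-1 = ((1 - a)^-1 + (1 + a)^-1) / 2]. *)
Lemma inverse_sub1_sqr a y1 y2 : is_inverse (1 - a) y1 -> is_inverse (1 + a) y2 ->
  is_inverse (1 - a * a) (sc 2^-1 * (y1 + y2)).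
Proof.
have e1 : 1 - a * a = (1 + a) * (1 - a).
  by rewrite mulrBr mulr1 mulrDl mul1r opprD addrA addrK.
have e2 : 1 - a * a = (1 - a) * (1 + a).
  by rewrite mulrDr mulr1 mulrBl mul1r addrA subrK.
have half2 : sc 2^-1 * (1 + a + (1 - a)) = 1.
  rewrite addrACA subrr addr0 -(rmorph1 sc) -rmorphD -rmorphM -mulr2n.
  by rewrite mulVf ?rmorph1 // pnatr_eq0.
move=> [h1 h1'] [h2 h2']; split.
  rewrite mulrA -scal_comm -mulrA mulrDr {1}e1 e2.
  by rewrite -(mulrA (1 + a)) h1 -(mulrA (1 - a)) h2 !mulr1.
rewrite -mulrA mulrDl {1}e2 e1 (mulrA y1) h1' (mulrA y2) h2' !mul1r.
exact: half2.
Qed.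

Lemma exists_root_opp1 n : exists2 w : R[i], w ^+ n.+1 = -1 & normc w = 1.
Proof.
exists (n.+1.-root (-1)); first exact: rootCK.
apply/eqP; rewrite -(@pexpr_eq1 _ _ n.+1) ?normc_ge0 //.
have normcX (k : R[i]) m : normc k ^+ m = normc (k ^+ m).
  by elim: m => [|m IH]; rewrite ?expr0 ?normc1 // !exprS normcM IH.
by rewrite normcX rootCK // -(rmorphN1 (real_complex R)) normc_real normrN1.
Qed.

(** Averaging the inverses at [k] and at [k * w], where [w ^+ n = -1], transfers a
    bound and a Lipschitz constant of the resolvent of [x], unchanged, to the
    resolvents of all [x ^+ (2 ^ m)]. *)
Lemma resolvent_pow2 x (L C : R) m :
    (forall k r s, normc k <= 1 -> 0 <= r <= 1 -> 0 <= s <= 1 ->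
      exists y z, [/\ is_inverse (1 - sc (r%:C%C * k) * x) y,
        is_inverse (1 - sc (s%:C%C * k) * x) z, `[y] <= L
        & `[y - z] <= C * `|r - s|]) ->
  forall k r s, normc k <= 1 -> 0 <= r <= 1 -> 0 <= s <= 1 ->
    exists y z, [/\ is_inverse (1 - (sc (r%:C%C * k) * x) ^+ (2 ^ m)) y,
      is_inverse (1 - (sc (s%:C%C * k) * x) ^+ (2 ^ m)) z, `[y] <= L
      & `[y - z] <= C * `|r - s|].
Proof.
move=> H; elim: m => [|m IH] k r s k1 r01 s01; first by rewrite expn0 !expr1; exact: H.
have [w wn w1] := exists_root_opp1 (2 ^ m).-1.
rewrite prednK ?expn_gt0 // in wn.
have [y1 [z1 [hy1 hz1 y1L yz1]]] := IH k r s k1 r01 s01.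
have [|y2 [z2 [hy2 hz2 y2L yz2]]] := IH (k * w) r s _ r01 s01.
  by rewrite normcM w1 mulr1.
have rot r' : 1 - (sc (r'%:C%C * (k * w)) * x) ^+ (2 ^ m) =
              1 + (sc (r'%:C%C * k) * x) ^+ (2 ^ m).
  rewrite mulrA mulrC rmorphM -mulrA exprMn_comm; last exact: scal_comm.
  by rewrite -rmorphXn wn rmorphN1 mulN1r opprK.
rewrite !rot in hy2 hz2.
exists (sc 2^-1 * (y1 + y2)), (sc 2^-1 * (z1 + z2)).
have half : normc (2^-1 : R[i]) = 2^-1.
  by rewrite normcV -(rmorph_nat (real_complex R)) normc_real normr_nat.
rewrite expnSr muln2 -addnn !exprD; split; try exact: inverse_sub1_sqr.
  by rewrite nrm_scal half; have := nrmD S y1 y2; lra.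
rewrite -mulrBr nrm_scal half opprD addrACA.
by have := nrmD S (y1 - z1) (y2 - z2); lra.
Qed.

Lemma nrm_scalX k x n : `[(sc k * x) ^+ n] = normc k ^+ n * `[x ^+ n].
Proof.
rewrite exprMn_comm; last exact: scal_comm.
elim: n (x ^+ n) => [|n IH] y; first by rewrite !expr0 !mul1r.
by rewrite !exprS -!mulrA nrm_scal IH.
Qed.

Lemma exists_pow2_root (a : R) m : 0 <= a -> exists2 t, 0 <= t & t ^+ (2 ^ m) = a.
Proof.
elim: m a => [|m IH] a a0; first by exists a.
have [t t0 tm] := IH (Num.sqrt a) (sqrtr_ge0 a).
by exists t => //; rewrite expnSr exprM tm sqr_sqrtr.
Qed.

(** If [a = nrm (x ^+ n) > 1] with [n = 2 ^ m], some [t < 1] makes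
    [t ^+ n * a] a small constant, so that the resolvent of [x ^+ n] is near [1]
    at [t], hence also at [s = min 1 (t + h)] by the Lipschitz bound, which is
    uniform in [m]; that keeps [s ^+ n * a <= 1].  For [s = 1] this contradicts
    [a > 1], and for [s = t + h] it bounds the ratio [(s / t) ^+ n], which
    exceeds [(1 + h) ^+ n], by a constant. *)
Lemma pow2_le1 x :
    (forall k, normc k <= 1 -> invertible (1 - sc k * x)) ->
  exists m, `[x ^+ (2 ^ m)] <= 1.
Proof.
move=> inv_x; have [L0 HL0] := resolvent_bounded inv_x.
pose L := `|L0| + 1; pose C := L * L * `[x].
have L1 : 1 <= L by rewrite /L; have := normr_ge0 L0; lra.
have C0 : 0 <= C by rewrite /C !mulr_ge0 ?nrm_ge0 //; lra.
have lipschitz k r s : normc k <= 1 -> 0 <= r <= 1 -> 0 <= s <= 1 ->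
  exists y z, [/\ is_inverse (1 - sc (r%:C%C * k) * x) y,
    is_inverse (1 - sc (s%:C%C * k) * x) z, `[y] <= L & `[y - z] <= C * `|r - s|].
  move=> k1 r01 s01.
  have le1 r' : 0 <= r' <= 1 -> normc (r'%:C%C * k) <= 1.
    move=> /andP[r0 r1]; rewrite normcM normc_real ger0_norm //.
    by have := normc_ge0 k; nra.
  have LL : L0 <= L by rewrite /L; have := ler_norm L0; lra.
  have [y hy yL] := HL0 _ (le1 r r01); have [z hz zL] := HL0 _ (le1 s s01).
  exists y, z; split => //; first exact: le_trans yL LL.
  have -> : y - z = y * ((sc ((r - s)%:C%C * k) * x) * z).
    have -> : sc ((r - s)%:C%C * k) * x =
        (1 - sc (s%:C%C * k) * x) - (1 - sc (r%:C%C * k) * x).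
      by rewrite rmorphB mulrBl rmorphB mulrBl opprB [RHS]addrC addrA subrK.
    by rewrite mulrBl mulrBr (proj1 hz) mulr1 mulrA (proj2 hy) mul1r.
  apply: le_trans (nrmM _ _ _) _.
  have h1 : `[y] <= L by exact: le_trans yL LL.
  have h2 : `[sc ((r - s)%:C%C * k) * x * z] <= `|r - s| * `[x] * L.
    apply: le_trans (nrmM _ _ _) _.
    apply: ler_pM; rewrite ?nrm_ge0 //; last exact: le_trans zL LL.
    rewrite nrm_scal normcM normc_real ler_wpM2r ?nrm_ge0 //.
    by rewrite ler_piMr.
  apply: le_trans (ler_pM (nrm_ge0 _ _) (nrm_ge0 _ _) h1 h2) _.
  by rewrite /C le_eqVlt; apply/orP; left; apply/eqP; ring.
pose h := (4 * (C + 1))^-1.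
have h0 : 0 < h by rewrite invr_gt0; lra.
have Ch : C * h <= 4^-1.
  have : h * (4 * (C + 1)) = 1 by rewrite mulVf //; lra.
  nra.
have [m Hm] := expr_unbounded (4 * L) h0.
have {}Hm := Hm (2 ^ m)%N (ltnW (ltn_expl m (isT : (1 < 2)%N))).
exists m; set n := (2 ^ m)%N in Hm *; rewrite leNgt; apply/negP => a1.
set a := `[x ^+ n] in a1.
have n0 : (0 < n)%N by rewrite expn_gt0.
have [|t t0 tn] := @exists_pow2_root ((4 * L)^-1 / a) m.
  by rewrite divr_ge0 ?invr_ge0; lra.
rewrite -/n in tn.
have tna : t ^+ n * a = (4 * L)^-1 by rewrite tn divfK //; lra.
have t1 : t <= 1.
  rewrite leNgt; apply/negP => /ltW t1; have := exprn_ege1 n t1.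
  have : (4 * L)^-1 <= 1 by rewrite invf_le1; lra.
  nra.
pose s := Num.min 1 (t + h).
have s01 : 0 <= s <= 1.
  by rewrite le_min ge_min lexx ler01 /= andbT; lra.
have ts : `|t - s| <= h.
  rewrite distrC ger0_norm; first by rewrite lerBlDl ge_min lexx orbT.
  by rewrite subr_ge0 le_min t1 /=; lra.
have normc1' : normc (1 : R[i]) <= 1 by rewrite normc1.
have t01 : 0 <= t <= 1 by rewrite t0.
have [y [z [hy hz yL yz]]] := resolvent_pow2 m lipschitz normc1' t01 s01.
rewrite !mulr1 -/n in hy hz.
have sr0 : 0 <= s by case/andP: s01.
set A := (sc t%:C%C * x) ^+ n in hy; set A' := (sc s%:C%C * x) ^+ n in hz.
have nA : `[A] = (4 * L)^-1.
  by rewrite nrm_scalX normc_real ger0_norm.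
have nA' : `[A'] = s ^+ n * a by rewrite nrm_scalX normc_real ger0_norm.
have y1 : `[y - 1] <= 4^-1.
  have -> : y - 1 = y * A by rewrite -{1}(proj2 hy) mulrBr mulr1 opprB addrC subrK.
  apply: le_trans (nrmM _ _ _) _; rewrite nA.
  have : (4 * L)^-1 * (4 * L) = 1 by rewrite mulVf //; lra.
  have : 0 < (4 * L)^-1 by rewrite invr_gt0; lra.
  nra.
have z1 : `[z - 1] <= 2^-1.
  have -> : z - 1 = (y - 1) - (y - z) by rewrite opprB [RHS]addrC addrA subrK.
  apply: le_trans (nrmB _ _ _) _.
  have : C * `|t - s| <= C * h by exact: ler_wpM2l.
  lra.
have {}nA' : s ^+ n * a <= 1.
  rewrite -nA'; have := nrmM S (z - 1) A'; have := nrmB S (z - 1) ((z - 1) * A').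
  have -> : (z - 1) - (z - 1) * A' = A'.
    have := proj2 hz; rewrite mulrBr mulr1 => e.
    by rewrite mulrBl mul1r opprB (addrC A') addrACA e addrA subrr add0r.
  have := nrm_ge0 S A'; nra.
have [th1|th1] := leP 1 (t + h).
  by move: nA'; rewrite /s min_l // expr1n mul1r leNgt a1.
move: nA'; rewrite /s min_r; last exact: ltW.
apply/negP; rewrite -ltNge.
have st : t * (1 + h) <= t + h by rewrite mulrDr mulr1; nra.
have : (t * (1 + h)) ^+ n * a <= (t + h) ^+ n * a.
  rewrite ler_wpM2r; [by []|lra|].
  by rewrite ler_pXn2r // nnegrE; nra.
apply: lt_le_trans.
rewrite exprMn mulrAC tna mulrC ltr_pdivlMr ?mul1r //; lra.
Qed.

Definition geometric_powers x :=
  exists M q : R, 0 <= q < 1 /\ forall n, `[x ^+ n] <= M * q ^+ n.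

(** The ratio [q] is close enough to [1] for Bernoulli's inequality to give
    [nrm (x ^+ N) <= q ^+ N]. *)
Lemma geometric_powersP x N : (0 < N)%N -> `[x ^+ N] < 1 -> geometric_powers x.
Proof.
move=> N0 xN1; pose q := 1 - (1 - Num.max `[x ^+ N] 2^-1) / N%:R.
have Np : 1 <= N%:R :> R by rewrite ler1n.
set b := Num.max _ _ in q; have b1 : b < 1 by rewrite gt_max xN1; lra.
have b2 : 2^-1 <= b by rewrite le_max lexx orbT.
have bN : 0 < (1 - b) / N%:R <= 1 - b.
  rewrite divr_gt0 /=; [|lra|lra].
  by rewrite ler_pdivrMr; [nra|lra].
have q0 : 0 < q by rewrite /q; lra.
have q1 : q < 1 by rewrite /q; lra.
have bqN : b <= q ^+ N.
  have := @bernoulli_expr R (- ((1 - b) / N%:R)) N.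
  rewrite mulrN mulrCA divff ?mulr1; last by lra.
  rewrite -/q; lra.
pose M := \sum_(j < N) `[x ^+ j] / q ^+ j.
have M0 : 0 <= M by apply: sumr_ge0 => j _; rewrite divr_ge0 ?nrm_ge0 ?exprn_ge0 // ltW.
exists M, q; split; first by rewrite (ltW q0).
elim/ltn_ind => n IH; have [nN|Nn] := ltnP n N.
  rewrite -ler_pdivrMr ?exprn_gt0 // /M (bigD1 (Ordinal nN)) //= lerDl.
  by apply: sumr_ge0 => j _; rewrite divr_ge0 ?nrm_ge0 ?exprn_ge0 // ltW.
rewrite -(subnKC Nn) exprD (le_trans (nrmM _ _ _)) //.
have IH' := IH (n - N)%N; rewrite ltn_subrL N0 (leq_trans N0 Nn) in IH'.
have -> : M * q ^+ (N + (n - N)) = q ^+ N * (M * q ^+ (n - N)).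
  by rewrite exprD mulrCA.
apply: ler_pM; rewrite ?nrm_ge0 //; last exact: IH'.
by apply: le_trans bqN; rewrite le_max lexx.
Qed.

(** A weak form of the spectral radius formula.  A bound of the resolvent on the
    unit disc extends the hypothesis to a larger disc, so that [pow2_le1] applies
    to a dilation of [x]. *)
Lemma spectral_geometric_powers x :
    (forall k, normc k <= 1 -> invertible (1 - sc k * x)) -> geometric_powers x.
Proof.
move=> inv_x; have [L0 HL0] := resolvent_bounded inv_x.
pose L := `|L0| + 1.
have L1 : 1 <= L by rewrite /L; have := normr_ge0 L0; lra.
have xL0 : 0 <= `[x] * L by rewrite mulr_ge0 ?nrm_ge0 //; lra.
pose e := (2 * (`[x] * L + 1))^-1.
have e0 : 0 < e by rewrite invr_gt0; lra.
have ex : e * `[x] * L <= 2^-1.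
  have : e * (2 * (`[x] * L + 1)) = 1 by rewrite mulVf //; lra.
  nra.
have [|m] := @pow2_le1 (sc (1 + e)%:C%C * x).
  move=> k k1; have [y hy yL] := HL0 k k1.
  have [|y' hy' _] := @resolvent_perturb x k (k * (1 + e)%:C%C) y hy.
    have -> : k * (1 + e)%:C%C - k = k * e%:C%C.
      by rewrite rmorphD rmorph1 mulrDr mulr1 addrC addKr.
    rewrite normcM normc_real gtr0_norm //; apply: le_trans ex.
    apply: ler_pM; rewrite ?nrm_ge0 //.
    - by rewrite !mulr_ge0 ?nrm_ge0 ?normc_ge0 ?ltW.
    - by rewrite ler_wpM2r ?nrm_ge0 // ler_piMl // ltW.
    - by rewrite /L; have := ler_norm L0; lra.
  by exists y'; rewrite mulrA -rmorphM.
have pm : (0 < 2 ^ m)%N by rewrite expn_gt0.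
rewrite nrm_scalX normc_real gtr0_norm => [H|]; last by lra.
apply: (geometric_powersP pm).
have e1 : 1 < (1 + e) ^+ (2 ^ m) by rewrite exprn_egt1 -?lt0n //; lra.
have := nrm_ge0 S (x ^+ (2 ^ m)); nra.
Qed.

Lemma geometric_powers_small x e : 0 < e -> geometric_powers x ->
  exists2 N, (0 < N)%N & `[x ^+ N] < e.
Proof.
move=> e0 [M [q [q01 H]]].
have Mp : 0 < `|M| + 1 by have := normr_ge0 M; lra.
have [N HN] := expr_small q01 (divr_gt0 e0 Mp).
exists N.+1 => //; apply: le_lt_trans (H _) _.
have := HN N.+1 (leqnSn N); rewrite ltr_pdivlMr // => HNe.
apply: le_lt_trans _ HNe; rewrite mulrC ler_wpM2l ?exprn_ge0 //.
  by case/andP: q01.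
by have := ler_norm M; lra.
Qed.

(** The spectrum of [p] lies in the open interval from [0] to [c], hence that of
    [1 - p / c] in the open unit disc. *)
Lemma spectrum_gt0_geometric_powers p (c : R) : `[p] < c ->
    (forall k, complex.Im k != 0 -> invertible (p - sc k)) ->
    (forall r, r <= 0 -> invertible (p - sc r%:C%C)) ->
  geometric_powers (1 - sc (c^-1)%:C%C * p).
Proof.
move=> pc inv_im inv_re; apply: spectral_geometric_powers => k k1.
have c0 : 0 < c by apply: le_lt_trans pc; exact: nrm_ge0.
have [->|k0] := eqVneq k 0.
  by rewrite rmorph0 mul0r subr0; exists 1; split; exact: mulr1.
have cC0 : (c%:C)%C != 0 :> R[i].
  by apply/eqP => /(@complexI R)/eqP; rewrite gt_eqF.
(* [1 - k (1 - p / c) = (k / c) (p - c (1 - 1 / k))] *)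
have -> : 1 - sc k * (1 - sc (c^-1)%:C%C * p) =
    sc (k * (c^-1)%:C%C) * (p - sc (c%:C%C * (1 - k^-1))).
  rewrite [sc k * _]mulrBr mulr1 mulrA -rmorphM mulrBr -rmorphM.
  have -> : k * (c^-1)%:C%C * (c%:C%C * (1 - k^-1)) = k - 1.
    by rewrite fmorphV mulrA divfK // mulrBr mulr1 divff.
  by rewrite rmorphB rmorph1 !opprB addrCA addrA.
apply: invertibleM.
  by apply: invertible_field; rewrite mulf_neq0 // fmorphV invr_neq0.
have [im0|] := eqVneq (complex.Im (c%:C%C * (1 - k^-1))) 0; last exact: inv_im.
set mu := c%:C%C * (1 - k^-1) in im0 *.
have mu_re : mu = (complex.Re mu)%:C%C by case: mu im0 => a b /= ->.
have [mu0|mu0] := leP (complex.Re mu) 0; first by rewrite mu_re; exact: inv_re.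
have kV : k^-1 = (1 - c^-1 * complex.Re mu)%:C%C.
  have -> : k^-1 = 1 - (c^-1)%:C%C * mu.
    by rewrite /mu fmorphV mulKf // opprB addrC subrK.
  by rewrite {1}mu_re rmorphB rmorph1 rmorphM.
have : 1 <= `|1 - c^-1 * complex.Re mu|.
  by rewrite -normc_real -kV normcV -invr1 lef_pV2 ?posrE ?normc_gt0.
have cV : 0 < c^-1 * complex.Re mu by rewrite mulr_gt0 ?invr_gt0.
rewrite real_ler_normr ?num_real // => /orP[|h]; first by lra.
have mu2 : c < complex.Re mu.
  have : c^-1 * complex.Re mu * c = complex.Re mu by rewrite mulrC mulrA divff ?mul1r // gt_eqF.
  nra.
rewrite -opprB -mulN1r -(rmorphN1 sc); apply: invertibleM.
  by apply: invertible_field; rewrite oppr_eq0 oner_neq0.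
apply: neumann_scal; rewrite mu_re normc_real gtr0_norm //.
exact: lt_trans mu2.
Qed.

Lemma geometric_powers_invertible x k :
  geometric_powers x -> normc k <= 1 -> invertible (1 - sc k * x).
Proof.
move=> gx k1; have [N N0 xN] := geometric_powers_small ltr01 gx.
apply: (@invertible_sub1_expr _ _ N); apply: (neumann (S := S)).
rewrite nrm_scalX; apply: le_lt_trans xN; rewrite ler_piMl ?nrm_ge0 //.
by rewrite exprn_ile1 ?normc_ge0.
Qed.

Lemma geometric_powers_sub_invertible x k :
  geometric_powers x -> 1 <= normc k -> invertible (sc k - x).
Proof.
move=> gx k1; have k0 : k != 0.
  by apply: contraTneq k1 => ->; rewrite normc0 ler10.
have -> : sc k - x = sc k * (1 - sc k^-1 * x).
  by rewrite mulrBr mulr1 mulrA -rmorphM divff // rmorph1 mul1r.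
apply: invertibleM; first exact: invertible_field.
by apply: geometric_powers_invertible => //; rewrite normcV invf_le1 // normc_gt0.
Qed.

End SpectralRadius.

(** * Square roots in rings with involution *)

Section StarRing.
Variable A : starRingType.
Implicit Types x y : A.

Lemma star1 : star (1 : A) = 1.
Proof. by rewrite -[LHS]mulr1 -{2}(starK 1) -starM mulr1 starK. Qed.

Lemma starN x : star (- x) = - star x.
Proof. by apply: (addrI (star x)); rewrite -starD !subrr star0. Qed.

Lemma starB x y : star (x - y) = star x - star y.
Proof. by rewrite starD starN. Qed.

Lemma star_sum I (r : seq I) (P : pred I) (F : I -> A) :
  star (\sum_(i <- r | P i) F i) = \sum_(i <- r | P i) star (F i).
Proof. exact: (big_morph _ (@starD A) (star0 A)). Qed.

Lemma star_inverse x y : is_inverse x y -> is_inverse (star x) (star y).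
Proof. by move=> [xy yx]; split; rewrite -starM ?xy ?yx star1. Qed.

Lemma star_invertible x : invertible x -> invertible (star x).
Proof. by move=> [y /star_inverse xy]; exists (star y). Qed.

Lemma inverse_self_adjoint x y : star x = x -> is_inverse x y -> star y = y.
Proof.
move=> xs xy; apply: (is_inverse_uniq _ xy); rewrite -{1}xs.
exact: star_inverse.
Qed.

End StarRing.

Definition star_scalars (R : realType) (A : starRingType)
    (f : {rmorphism R[i] -> A}) :=
  (forall k x, f k * x = x * f k) /\ (forall k, star (f k) = f (conjc k)).

Section StarScalars.
Variables (R : realType) (A : starRingType) (f : {rmorphism R[i] -> A}).
Hypothesis fS : star_scalars f.
Implicit Types (x y : A) (k : R[i]) (r : R).

Lemma star_scal k x : star (f k * x) = f (conjc k) * star x.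
Proof. by rewrite starM (proj2 fS) -(proj1 fS). Qed.

Lemma star_real r : star (f r%:C%C) = f r%:C%C.
Proof. by rewrite (proj2 fS) /conjc /= oppr0. Qed.

Lemma star_scal_real r x : star (f r%:C%C * x) = f r%:C%C * star x.
Proof. by rewrite star_scal /conjc /= oppr0. Qed.

(** [(h - a)^2 / b^2 + 1] is the product of [(h - a) / b - i] and its conjugate. *)
Lemma self_adjoint_nonreal_invertible h k : star_symmetric A ->
  star h = h -> complex.Im k != 0 -> invertible (h - f k).
Proof.
case: k => a b symA hs /= b0.
have bC0 : (b%:C)%C != 0 :> R[i] by apply/eqP => /(@complexI R)/eqP; exact/negP.
pose g := f (b^-1)%:C%C * (h - f a%:C%C).
have gs : star g = g by rewrite star_scal_real starB star_real hs.
have ii : f 'i%C * f 'i%C = -1.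
  by rewrite -rmorphM -expr2 sqr_i rmorphN1.
have gi : 1 + g * g = (g - f 'i%C) * (g + f 'i%C).
  by rewrite mulrDr !mulrBl ii opprK (proj1 fS _ g) addrA subrK addrC.
have -> : h - f (a +i* b)%C = f b%:C%C * (g - f 'i%C).
  have -> : (a +i* b)%C = a%:C%C + b%:C%C * 'i%C.
    by rewrite [LHS]complexE mulrC.
  rewrite mulrBr {1}/g mulrA -!rmorphM divff // !rmorph1 mul1r rmorphD opprD.
  by rewrite addrA.
apply: invertibleM; first exact: invertible_field.
apply: (@invertible_comm_factor _ _ (g + f 'i%C)).
  apply: commr_sym; apply: commrB; last exact: commr_sym (proj1 fS _ _).
  by apply: commr_sym; apply: commrD; [exact: commr_refl | exact: commr_sym (proj1 fS _ _)].
by rewrite -gi -{1}gs; exact: symA.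
Qed.
End StarScalars.

Section SquareRoot.
Variables (R : realType) (A : starRingType) (S : banach_ring R A).
Hypothesis starS : star_scalars (scal S).
Implicit Types (u x y z a b p w : A) (k : R[i]) (r s t : R).
Local Notation sc := (scal S).
Local Notation "`[ x ]" := (nrm S x) (at level 0, x at level 99).

(** A bound on the operator norm of left multiplication by [a], for the norm
    [b |-> sup_n nrm (u ^+ n * b) / q ^+ n].  Left multiplication by [u] has norm
    at most [q] for it, and it is finite when the powers of [u] are dominated by
    those of [q].  The bounds on [b] are kept as hypotheses instead of taking the
    supremum. *)
Definition opnorm_le u (q : R) a t := forall b s,
  (forall n, `[u ^+ n * b] <= s * q ^+ n) ->
  forall n, `[u ^+ n * (a * b)] <= t * s * q ^+ n.

Section OperatorNorm.
Variables (u : A) (q : R).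
Hypothesis q0 : 0 <= q.
Local Notation op := (opnorm_le u q).

Lemma opnorm_le_self : op u q.
Proof.
by move=> b s H n; rewrite mulrA -exprSr -(mulrC s) -mulrA -exprS.
Qed.

Lemma opnorm_leD a b r t : op a r -> op b t -> op (a + b) (r + t).
Proof.
move=> ha hb c s H n; rewrite mulrDl mulrDr !mulrDl.
by apply: le_trans (nrmD _ _ _) _; apply: lerD; [exact: ha | exact: hb].
Qed.

Lemma opnorm_leM a b r t : op a r -> op b t -> op (a * b) (r * t).
Proof.
by move=> ha hb c s H n; rewrite -(mulrA a) -(mulrA r); apply: ha => m; exact: hb.
Qed.

Lemma opnorm_le_scal k a t : op a t -> op (sc k * a) (normc k * t).
Proof.
move=> ha b s H n.
rewrite -(mulrA (sc k)) (mulrA (u ^+ n)) -scal_comm -(mulrA (sc k)) nrm_scal -!mulrA.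
by rewrite ler_wpM2l ?normc_ge0 // (mulrA t); exact: ha.
Qed.

Lemma opnorm_leW a r t : r <= t -> op a r -> op a t.
Proof.
move=> rt ha b s H n; apply: le_trans (ha b s H n) _.
rewrite -!mulrA ler_wpM2r // mulr_ge0 ?exprn_ge0 //.
by have := H 0; rewrite !expr0 mul1r mulr1; apply: le_trans; exact: nrm_ge0.
Qed.

Lemma opnorm_le0 : op 0 0.
Proof. by move=> b s H n; rewrite mul0r mulr0 !mul0r nrm0. Qed.

Lemma opnorm_leX a t n : op a t -> op (a ^+ n) (t ^+ n).
Proof.
move=> ha; elim: n => [|n IH]; last by rewrite !exprS; exact: opnorm_leM.
by rewrite !expr0 => b s H n; rewrite !mul1r.
Qed.

(** Operator bounds pass to limits, here of geometric speed. *)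
Lemma opnorm_le_lim (f : nat -> A) a t (C c : R) : 0 <= c < 1 ->
  (forall m, op (f m) t) -> (forall m, `[a - f m] <= C * c ^+ m) -> op a t.
Proof.
move=> c01 hf fa b s H n; rewrite -subr_le0.
apply: (@geometric_le0 _ _ (`[u ^+ n] * C * `[b]) c c01) => m.
have -> : a * b = (a - f m) * b + f m * b by rewrite -mulrDl subrK.
rewrite lerBlDr mulrDr; apply: le_trans (nrmD _ _ _) _.
apply: lerD; last exact: hf.
rewrite mulrA; apply: le_trans (nrmM _ _ _) _.
rewrite [leRHS]mulrAC ler_wpM2r ?nrm_ge0 //.
by apply: le_trans (nrmM _ _ _) _; rewrite -mulrA ler_wpM2l ?nrm_ge0.
Qed.

Lemma opnorm_le_nrm a t (M : R) :
  (forall n, `[u ^+ n] <= M * q ^+ n) -> op a t -> `[a] <= t * M.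
Proof.
move=> uM /(_ 1 M) H; have := H _ 0; rewrite expr0 mul1r !mulr1; apply.
by move=> n; rewrite mulr1.
Qed.

End OperatorNorm.

(** [z = 1 - (1 - u)^(1/2)] is the fixed point of [z |-> (u + z ^+ 2) / 2]; for
    the operator norm above, this map is a contraction of ratio [(1 + q) / 2]
    on the ball of that radius. *)
Lemma sqrt_fixpoint u : geometric_powers S u ->
  exists z, [/\ z = sc 2^-1 * (u + z * z), geometric_powers S z
    & forall x, GRing.comm x u -> GRing.comm x z].
Proof.
move=> [M [q [/andP[q0 q1] uM]]].
(* [c] satisfies [(q + c ^+ 2) / 2 <= c], so that the ball of radius [c] is stable. *)
pose c := (1 + q) / 2.
have half : normc (2^-1 : R[i]) = 2^-1.
  by rewrite normcV -(rmorph_nat (real_complex R)) normc_real normr_nat.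
have c01 : 0 <= c < 1 by rewrite /c; lra.
have c0 : 0 <= c by case/andP: c01.
pose step z := sc 2^-1 * (u + z * z); pose f n := iter n step 0.
have op_f n : opnorm_le u q (f n) c.
  elim: n => [|n IH]; first exact (opnorm_leW q0 c0 (@opnorm_le0 u q)).
  apply: (@opnorm_leW _ _ q0 _ (normc (2^-1 : R[i]) * (q + c * c))).
    by rewrite half /c; nra.
  apply: opnorm_le_scal => //; apply: opnorm_leD; last exact: opnorm_leM.
  exact: opnorm_le_self.
have op_df n : opnorm_le u q (f n.+1 - f n) (c ^+ n).
  elim: n => [|n IH].
    rewrite expr0 subr0 /= /step mulr0 addr0.
    apply: (@opnorm_leW _ _ q0 _ (normc (2^-1 : R[i]) * q)).
      by rewrite half; lra.
    by apply: opnorm_le_scal; exact: opnorm_le_self.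
  have -> : f n.+2 - f n.+1 =
      sc 2^-1 * (f n.+1 * (f n.+1 - f n) + (f n.+1 - f n) * f n).
    rewrite [f n.+2]/= [in LHS]/= -!/(f _) /step -mulrBr; congr (_ * _).
    rewrite mulrBr mulrBl addrA subrK opprD addrACA subrr add0r.
    by [].
  apply: (@opnorm_leW _ _ q0 _ (normc (2^-1 : R[i]) * (c * c ^+ n + c ^+ n * c))).
    by rewrite half exprS; nra.
  by apply: opnorm_le_scal => //; apply: opnorm_leD => //; exact: opnorm_leM.
have [z [C Hz]] : exists z C, forall n, `[z - f n] <= C * c ^+ n.
  apply: (nrm_complete (C := M)) => // n.
  by rewrite mulrC; exact: (opnorm_le_nrm uM (op_df n)).
have op_z : opnorm_le u q z c by exact: opnorm_le_lim c01 op_f Hz.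
have z_le := opnorm_le_nrm uM op_z.
exists z; split.
- apply/subr0_eq; apply: (@nrm_geometric_eq0 _ _ S _ (C + c * M * C) _ c01) => n.
  have -> : z - sc 2^-1 * (u + z * z) = (z - f n.+1) -
      sc 2^-1 * ((z - f n) * z + f n * (z - f n)).
    rewrite [f n.+1]/= -/(f n) /step mulrBl mulrBr addrA subrK.
    rewrite -addrA -opprD -mulrDr; congr (_ - _ * _).
    by rewrite addrA addrAC addrK.
  apply: le_trans (nrmB _ _ _) _; rewrite nrm_scal half.
  have h1 := Hz n; have h2 := Hz n.+1.
  have fn_le : `[f n] <= c * M by exact: (opnorm_le_nrm uM (op_f n)).
  have h3 := nrmD S ((z - f n) * z) (f n * (z - f n)).
  have h4 : `[(z - f n) * z] <= C * c ^+ n * (c * M).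
    by apply: le_trans (nrmM _ _ _) _; apply: ler_pM; rewrite ?nrm_ge0.
  have h5 : `[f n * (z - f n)] <= c * M * (C * c ^+ n).
    by apply: le_trans (nrmM _ _ _) _; apply: ler_pM; rewrite ?nrm_ge0.
  have h6 : C * c ^+ n.+1 <= C * c ^+ n.
    have : 0 <= C * c ^+ n by apply: le_trans h1; exact: nrm_ge0.
    by rewrite exprS; case/andP: c01; nra.
  rewrite [leRHS]mulrDl.
  have -> : c * M * C * c ^+ n = c * M * (C * c ^+ n) by rewrite -!mulrA.
  lra.
- exists M, c; split => // n; rewrite mulrC.
  by apply: (opnorm_le_nrm uM); exact: opnorm_leX.
- move=> x xu; have xf n : GRing.comm x (f n).
    elim: n => [|n IH]; first exact: commr0.
    apply: commrM; first exact/commr_sym/scal_comm.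
    by apply: commrD => //; exact: commrM.
  apply/subr0_eq.
  apply: (@nrm_geometric_eq0 _ _ S _ (`[x] * C + C * `[x]) _ c01) => n.
  have -> : x * z - z * x = x * (z - f n) - (z - f n) * x.
    by rewrite mulrBr mulrBl xf opprB addrA subrK.
  apply: le_trans (nrmB _ _ _) _.
  rewrite [leRHS]mulrDl; apply: lerD; apply: le_trans (nrmM _ _ _) _.
    by rewrite -[leRHS]mulrA ler_wpM2l ?nrm_ge0.
  by rewrite [leRHS]mulrAC ler_wpM2r ?nrm_ge0.
Qed.

Lemma normc_conj k : normc (conjc k) = normc k.
Proof. by case: k => a b /=; rewrite sqrrN. Qed.

Lemma geometric_powers_star z : geometric_powers S z -> geometric_powers S (star z).
Proof.
move=> gz; apply: spectral_geometric_powers => k k1.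
have -> : 1 - sc k * star z = star (1 - sc (conjc k) * z).
  by rewrite starB star1 star_scal // conjcK.
by apply: star_invertible; apply: geometric_powers_invertible => //; rewrite normc_conj.
Qed.

(** The involution need not be continuous, so that the limit [z] of polynomials
    in [u] is not self-adjoint for that reason.  But [star z] is another fixed
    point, and commutes with [z]; hence [d = z - star z] satisfies
    [(2 - z) d = star z d], where the spectrum of [star z] lies in the open unit
    disc and that of [2 - z] outside the closed one.  So [d = 0]. *)
Lemma sqrt_sub1_self_adjoint u : star u = u -> geometric_powers S u ->
  exists2 w, star w = w & w * w = 1 - u.
Proof.
move=> us /sqrt_fixpoint[z [zE gz zcomm]].
have half2 : sc 2^-1 + sc 2^-1 = 1.
  by rewrite -rmorphD -(rmorph1 sc); congr (sc _); field.
have z2 : z + z = u + z * z by rewrite {1 2}zE -mulrDl half2 mul1r.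
set z' := star z.
have z'2 : z' + z' = u + z' * z' by have := congr1 star z2; rewrite !starD us starM.
have zu : GRing.comm u z by exact/zcomm/commr_refl.
have z'z : GRing.comm z' z.
  by apply: zcomm; rewrite /GRing.comm /z' -us -!starM zu.
suff d0 : z - z' = 0.
  exists (1 - z); first by rewrite starB star1 -/z' -(subr0_eq d0).
  have -> : u = z + z - z * z by rewrite z2 addrK.
  by rewrite mulrBr mulr1 mulrBl mul1r -addrA -opprD addrA.
set d := z - z'.
have gz' : geometric_powers S z' by exact: geometric_powers_star.
have normc2 k : normc k <= 1 -> 1 <= normc (2 - k).
  move=> k1; have := @le_normcD R (2 - k) k.
  rewrite subrK -(rmorph_nat (real_complex R)) normc_real normr_nat; lra.
have [|y hy] := @geometric_powers_sub_invertible _ _ S z 2 gz.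
  by rewrite -(rmorph_nat (real_complex R)) normc_real normr_nat; lra.
have gy : geometric_powers S y.
  apply: spectral_geometric_powers => k k1.
  have -> : 1 - sc k * y = (sc (2 - k) - z) * y.
    by rewrite rmorphB addrAC mulrBl (proj1 hy).
  apply: invertibleM; last by exists (sc 2 - z); split; case: hy.
  by apply: geometric_powers_sub_invertible gz _; exact: normc2.
have yz' : GRing.comm z' y.
  by apply: comm_inverse hy _; apply: commrB => //; exact/commr_sym/scal_comm.
have dE : d = y * z' * d.
  have e : (sc 2 - z) * d = z' * d.
    have dd : d + d = (z + z') * d.
      rewrite {3}/d mulrBr !mulrDl z'z opprD [RHS]addrA addrK.
      by rewrite /d addrACA -opprD z2 z'2 opprD addrACA subrr add0r.
    by rewrite mulrBl rmorph_nat mulr_natl mulr2n dd -mulrBl addrAC subrr add0r.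
  by rewrite -[LHS]mul1r -(proj2 hy) -!mulrA e.
have dX n : d = y ^+ n * z' ^+ n * d.
  rewrite -exprMn_comm; last exact: commr_sym.
  by elim: n => [|n IH]; [rewrite expr0 mul1r | rewrite exprSr -mulrA -dE].
have [M [q [q01 yM]]] := gy; have [M' [q' [/andP[q'0 q'1] zM']]] := gz'.
apply: (@nrm_geometric_eq0 _ _ S _ (M * M' * `[d]) _ q01) => n.
rewrite {1}(dX n); apply: le_trans (nrmM _ _ _) _.
rewrite [leRHS]mulrAC ler_wpM2r ?nrm_ge0 //; apply: le_trans (nrmM _ _ _) _.
rewrite mulrAC; apply: ler_pM; rewrite ?nrm_ge0 //.
apply: le_trans (zM' n) _; apply: ler_piMr.
  by have := zM' 0; rewrite expr0 mulr1; apply: le_trans; exact: nrm_ge0.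
by rewrite exprn_ile1 // ltW.
Qed.

(** For large [c] the powers of [1 - p / c] decay geometrically, as the spectrum of
    [p] is real and positive; so [p / c] has a square root. *)
Lemma sqrt_positive p : star_symmetric A -> star p = p ->
    (forall r, r <= 0 -> invertible (p - sc r%:C%C)) ->
  exists2 w, star w = w & w * w = p.
Proof.
move=> symA ps inv_p; pose c := `[p] + 1.
have c0 : 0 < c by rewrite /c; have := nrm_ge0 S p; lra.
have [| |w ws w2] := @sqrt_sub1_self_adjoint (1 - sc (c^-1)%:C%C * p).
- by rewrite starB star1 star_scal_real // ps.
- apply: spectrum_gt0_geometric_powers => //; first by rewrite /c; lra.
  by move=> k k0; apply: self_adjoint_nonreal_invertible starS _ _ _ _ _.
exists (sc (Num.sqrt c)%:C%C * w); first by rewrite star_scal_real ?ws.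
rewrite mulrA -(mulrA (sc _)) -scal_comm mulrA -!rmorphM -expr2 sqr_sqrtr ?ltW //.
rewrite -mulrA w2 opprB addrC subrK mulrA -!rmorphM divff ?gt_eqF //.
by rewrite !rmorph1 mul1r.
Qed.

End SquareRoot.

(** * Matrix rings *)

Section MatrixBanachRing.
Variables (R : realType) (D : pzRingType) (S : banach_ring R D) (n : nat).
Implicit Types (X Y : 'M[D]_n).

Definition nrm_mx X : R := \sum_i \sum_j nrm S (X i j).

Definition scal_mx : {rmorphism R[i] -> 'M[D]_n} := @scalar_mx D n \o scal S.

Lemma scal_mxE k X i j : (scal_mx k * X) i j = scal S k * X i j.
Proof. by rewrite [scal_mx k * X]mul_scalar_mx mxE. Qed.

Lemma scal_mx_comm k X : scal_mx k * X = X * scal_mx k.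
Proof.
apply/matrixP => i j; rewrite scal_mxE scal_comm.
have -> : X * scal_mx k = X *m diag_mx (const_mx (scal S k)) by rewrite diag_const_mx.
by rewrite mul_mx_diag !mxE.
Qed.

Lemma nrm_le_mx X i j : nrm S (X i j) <= nrm_mx X.
Proof.
rewrite /nrm_mx (bigD1 i) //= (bigD1 j) //= -addrA lerDl.
rewrite addr_ge0 ?sumr_ge0 // => *; rewrite ?sumr_ge0 // => *; exact: nrm_ge0.
Qed.

Lemma nrm_mx_ge0 X : 0 <= nrm_mx X.
Proof. by do 2 apply: sumr_ge0 => ? _; exact: nrm_ge0. Qed.

Lemma nrm_mx0_eq0 X : nrm_mx X = 0 -> X = 0.
Proof.
move=> X0; apply/matrixP => i j; rewrite mxE; apply: (@nrm_eq0 _ _ S).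
by rewrite -X0 nrm_le_mx.
Qed.

Lemma nrm_mxD X Y : nrm_mx (X + Y) <= nrm_mx X + nrm_mx Y.
Proof.
rewrite /nrm_mx -big_split; apply: ler_sum => i _ /=.
by rewrite -big_split; apply: ler_sum => j _ /=; rewrite mxE nrmD.
Qed.

Lemma nrm_sum I (r : seq I) (P : pred I) (F : I -> D) :
  nrm S (\sum_(i <- r | P i) F i) <= \sum_(i <- r | P i) nrm S (F i).
Proof.
elim/big_rec2: _ => [|i y z _ h]; first by rewrite nrm0.
by apply: le_trans (nrmD _ _ _) _; rewrite lerD2l.
Qed.

Lemma nrm_mxM X Y : nrm_mx (X * Y) <= nrm_mx X * nrm_mx Y.
Proof.
rewrite /nrm_mx mulr_suml; apply: ler_sum => i _.
have entry j : nrm S ((X * Y) i j) <= \sum_k nrm S (X i k) * nrm S (Y k j).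
  rewrite mxE; apply: le_trans (nrm_sum _ _ _) _.
  by apply: ler_sum => k _; exact: nrmM.
apply: le_trans (ler_sum _ (fun j _ => entry j)) _.
rewrite exchange_big mulr_suml; apply: ler_sum => k _ /=.
rewrite -mulr_sumr ler_wpM2l ?nrm_ge0 // [leRHS](bigD1 k) //= lerDl.
by do 2 apply: sumr_ge0 => ? _; exact: nrm_ge0.
Qed.

Lemma nrm_scal_mx k X : nrm_mx (scal_mx k * X) = normc k * nrm_mx X.
Proof.
rewrite /nrm_mx mulr_sumr; apply: eq_bigr => i _.
by rewrite mulr_sumr; apply: eq_bigr => j _; rewrite scal_mxE nrm_scal.
Qed.

Lemma nrm_mx_complete (f : nat -> 'M[D]_n) (C q : R) : 0 <= q < 1 ->
    (forall m, nrm_mx (f m.+1 - f m) <= C * q ^+ m) ->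
  exists L C', forall m, nrm_mx (L - f m) <= C' * q ^+ m.
Proof.
move=> q01 H.
have lim i j : exists lc : D * R,
    forall m, nrm S (lc.1 - f m i j) <= lc.2 * q ^+ m.
  have [|l [c lc]] := @nrm_complete _ _ S (fun m => f m i j) C q q01.
    move=> m; apply: le_trans (H m).
    by have := nrm_le_mx (f m.+1 - f m) i j; rewrite !mxE.
  by exists (l, c).
have {lim} lim i : exists g : 'I_n -> D * R, forall j m,
    nrm S ((g j).1 - f m i j) <= (g j).2 * q ^+ m.
  by have [g hg] := choice (lim i); exists g.
have [g hg] := choice lim.
exists (\matrix_(i, j) (g i j).1), (\sum_i \sum_j (g i j).2) => m.
rewrite mulr_suml; apply: ler_sum => i _; rewrite mulr_suml.
by apply: ler_sum => j _; rewrite !mxE.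
Qed.

Definition matrix_banach_ring : banach_ring R 'M[D]_n :=
  BanachRing scal_mx_comm nrm_mx_ge0 nrm_mx0_eq0 nrm_mxD nrm_mxM nrm_scal_mx
    nrm_mx_complete.

End MatrixBanachRing.

Lemma star_scalars_mx (R : realType) (A : starRingType) (S : banach_ring R A) n :
  star_scalars (scal S) -> star_scalars (scal (matrix_banach_ring S n)).
Proof.
move=> [scC scS]; split=> [k X|k]; first exact: scal_comm.
apply/matrixP => i j; rewrite !mxE eq_sym.
by case: eqP; rewrite ?mulr1n ?scS // mulr0n star0.
Qed.

Definition adjmx (A : starRingType) m n (T : 'M[A]_(m, n)) : 'M[A]_(n, m) :=
  map_mx star T^T.

Section AdjointMatrix.
Variable A : starRingType.

Lemma adjmxE n (T : 'M[A]_n) : adjmx T = star T.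
Proof. by apply/matrixP => i j; rewrite !mxE. Qed.

Lemma adjmxK m n (T : 'M[A]_(m, n)) : adjmx (adjmx T) = T.
Proof. by apply/matrixP => i j; rewrite !mxE starK. Qed.

Lemma adjmxB m n (T U : 'M[A]_(m, n)) : adjmx (T - U) = adjmx T - adjmx U.
Proof. by apply/matrixP => i j; rewrite !mxE starB. Qed.

Lemma adjmxM m n p (T : 'M[A]_(m, n)) (U : 'M[A]_(n, p)) :
  adjmx (T *m U) = adjmx U *m adjmx T.
Proof.
apply/matrixP => i j; rewrite !mxE star_sum.
by apply: eq_bigr => k _; rewrite !mxE starM.
Qed.

Lemma adjmx_row_mx m n1 n2 (T : 'M[A]_(m, n1)) (U : 'M[A]_(m, n2)) :
  adjmx (row_mx T U) = col_mx (adjmx T) (adjmx U).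
Proof. by rewrite /adjmx tr_row_mx map_col_mx. Qed.

Lemma adjmx_col_mx m1 m2 n (T : 'M[A]_(m1, n)) (U : 'M[A]_(m2, n)) :
  adjmx (col_mx T U) = row_mx (adjmx T) (adjmx U).
Proof. by rewrite /adjmx tr_col_mx map_row_mx. Qed.

(** The number of rows of [T] is arbitrary, so that these matrices are closed
    under addition. *)
Definition gram_mx n (X : 'M[A]_n) :=
  exists m (T : 'M[A]_(m, n)), X = adjmx T *m T.

Lemma gram_mxD n (X Y : 'M[A]_n) : gram_mx X -> gram_mx Y -> gram_mx (X + Y).
Proof.
move=> [m [T ->]] [p [U ->]]; exists (m + p)%N, (col_mx T U).
by rewrite adjmx_col_mx mul_row_col.
Qed.

Lemma gram_mx_sum n I (r : seq I) (F : I -> 'M[A]_n) :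
  (forall i, gram_mx (F i)) -> gram_mx (\sum_(i <- r) F i).
Proof.
move=> gF; elim/big_rec: _ => [|i X _ gX]; last exact: gram_mxD.
by exists 0, 0; rewrite mulmx0.
Qed.

End AdjointMatrix.

(** Block elimination, with the Schur complement of [a] as second pivot. *)
Lemma block_invertible (D : pzRingType) n1 n2 (a a' : 'M[D]_n1)
    (b : 'M[D]_(n1, n2)) (c : 'M[D]_(n2, n1)) (d : 'M[D]_n2) :
  is_inverse a a' -> invertible (d - c *m a' *m b) ->
  invertible (block_mx a b c d : 'M[D]_(n1 + n2)).
Proof.
move=> [aa' a'a] [s' [ss' s's]].
have unitriangular (u : 'M[D]_(n2, n1)) :
    invertible (block_mx 1%:M 0 u 1%:M : 'M[D]_(n1 + n2)).
  exists (block_mx 1%:M 0 (- u) 1%:M); split;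
  rewrite [LHS]mulmx_block !mulmx0 !mul0mx !mulmx1 !mul1mx !addr0 !add0r.
    by rewrite subrr -scalar_mx_block.
  by rewrite addNr -scalar_mx_block.
have unitriangular' (u : 'M[D]_(n1, n2)) :
    invertible (block_mx 1%:M u 0 1%:M : 'M[D]_(n1 + n2)).
  exists (block_mx 1%:M (- u) 0 1%:M); split;
  rewrite [LHS]mulmx_block !mulmx0 !mul0mx !mulmx1 !mul1mx !addr0 !add0r.
    by rewrite addNr -scalar_mx_block.
  by rewrite subrr -scalar_mx_block.
have diag : invertible (block_mx a 0 0 (d - c *m a' *m b) : 'M[D]_(n1 + n2)).
  exists (block_mx a' 0 0 s'); split;
  rewrite [LHS]mulmx_block !mulmx0 !mul0mx !addr0 !add0r.
    by rewrite [a *m _]aa' [_ *m s']ss' -scalar_mx_block.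
  by rewrite [a' *m _]a'a [s' *m _]s's -scalar_mx_block.
have -> : block_mx a b c d = block_mx 1%:M 0 (c *m a') 1%:M *
    (block_mx a 0 0 (d - c *m a' *m b) * block_mx 1%:M (a' *m b) 0 1%:M).
  rewrite [X in _ = _ * X]mulmx_block [RHS]mulmx_block.
  rewrite !mulmx0 !mul0mx !mulmx1 !mul1mx !addr0 !add0r.
  rewrite !mulmxA [a *m a']aa' mul1mx -!mulmxA [a' *m (a *m _)]mulmxA.
  rewrite [a' *m a]a'a mul1mx mulmx1.
  by rewrite !mulmxA addrC subrK.
exact: invertibleM (invertibleM _ _).
Qed.

(** * Symmetry of matrix rings *)

Section SymmetricMatrices.
Variables (R : realType) (A : starRingType) (S : banach_ring R A).
Hypothesis starS : star_scalars (scal S).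
Hypothesis symA : star_symmetric A.
Implicit Types (x y : A).
Local Notation sc := (scal S).

(** Let [p = 1 + \sum_(t <- s) t^* t].  For [r <= 0], [p - r] is [1 - r] times an
    element of the same form, hence invertible by induction.  So [p = w ^ 2] with
    [w] self-adjoint, and another square [y^* y] is absorbed by symmetry of [A]. *)
Lemma sum_squares_invertible (s : seq A) :
  invertible (1 + \sum_(t <- s) star t * t).
Proof.
have [m] := ubnP (size s); elim: m s => // m IH [|y s] /=.
  by move=> _; rewrite big_nil addr0; exists 1; split; exact: mulr1.
rewrite ltnS => sm.
set p := 1 + \sum_(t <- s) star t * t.
have ps : star p = p.
  rewrite starD star1 star_sum; congr (_ + _).
  by apply: eq_bigr => t _; rewrite starM starK.
have [|w ws w2] := sqrt_positive starS symA ps.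
  move=> r r0; pose a := Num.sqrt (1 - r).
  have a0 : 0 < a by rewrite sqrtr_gt0; lra.
  have aa : a * a = 1 - r by rewrite -expr2 sqr_sqrtr //; lra.
  have -> : p - sc r%:C%C = sc (a * a)%:C%C *
      (1 + \sum_(t <- [seq sc (a^-1)%:C%C * t | t <- s]) star t * t).
    have -> : p - sc r%:C%C = sc (a * a)%:C%C + \sum_(t <- s) star t * t.
      by rewrite aa !rmorphB !rmorph1 addrAC.
    rewrite big_map mulrDr mulr1 mulr_sumr; congr (_ + _).
    apply: eq_bigr => t _; rewrite star_scal_real //.
    rewrite -mulrA (mulrA (star t)) -(scal_comm S _ (star t)) !mulrA -!rmorphM.
    by rewrite mulfK ?gt_eqF // divff ?gt_eqF // !rmorph1 mul1r.
  apply: invertibleM; last by apply: IH; rewrite size_map.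
  have aa0 : a * a != 0 by rewrite mulf_neq0 // gt_eqF.
  by apply: invertible_field; apply/eqP => /(@complexI R)/eqP; exact/negP.
have [w' ww'] : invertible w.
  apply: (@invertible_comm_factor _ _ w); first exact: commr_refl.
  by rewrite w2; exact: IH.
have w's := inverse_self_adjoint ws ww'.
(* [p + y^* y = w (1 + (y w^-1)^* (y w^-1)) w] *)
have -> : 1 + \sum_(t <- y :: s) star t * t =
    w * (1 + star (y * w') * (y * w')) * w.
  rewrite big_cons addrCA -/p -w2 mulrDr mulr1 mulrDl addrC; congr (_ + _).
  rewrite starM w's !mulrA (proj1 ww') mul1r.
  by rewrite -!mulrA (proj2 ww') mulr1.
by apply: invertibleM; [apply: invertibleM; [|exact: symA] |]; exists w'.
Qed.

(** Induction on the number of columns, by the Schur complement with respect to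
    the first column [t] of [T = (t | U)]: with [q = (1 + t t^* )^-1], it is
    [1 + U^* q U = 1 + (q U)^* (q U) + (t^* q U)^* (t^* q U)], a matrix of the
    same form with one more row and one less column. *)
Lemma gram_mx_invertible n (X : 'M[A]_n) : gram_mx X -> invertible (1 + X).
Proof.
move=> [m [T ->]] {X}; elim: n m T => [|n IH] m T.
  by exists 0; split; apply/matrixP => -[].
rewrite -(hsubmxK (T : 'M_(m, 1 + n))).
set t := lsubmx _; set U := rsubmx _.
have [x' xx'] := sum_squares_invertible [seq t k 0 | k <- enum 'I_m].
set x := 1 + _ in xx'; pose a := 1%:M + adjmx t *m t.
have aE : a = x%:M.
  apply/matrixP => i j; rewrite !ord1 !mxE /= !mulr1n; congr (_ + _).
  rewrite big_map big_enum; apply: eq_bigr => k _; by rewrite !mxE.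
have aa' : is_inverse (a : 'M_1) x'%:M.
  by rewrite aE; apply: (is_inverse_morph (@scalar_mx A 1)).
have x'M : adjmx (x'%:M : 'M_1) = x'%:M.
  rewrite adjmxE; apply: inverse_self_adjoint aa'; rewrite -adjmxE /a.
  rewrite adjmxE starD star1 -adjmxE adjmxM adjmxK.
  by [].
have gT : 1 + adjmx (row_mx t U) *m row_mx t U =
    block_mx a (adjmx t *m U) (adjmx U *m t) (1%:M + adjmx U *m U).
  rewrite adjmx_row_mx mul_col_row -[1]/(1%:M) (@scalar_mx_block _ 1 n) add_block_mx.
  by rewrite !add0r.
rewrite gT; apply: (block_invertible aa').
pose q : 'M_m := 1%:M - t *m x'%:M *m adjmx t.
have qs : adjmx q = q.
  rewrite adjmxB !adjmxM adjmxK x'M mulmxA; congr (_ - _).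
  by rewrite adjmxE star1.
have qV : (1%:M + t *m adjmx t) *m q = 1%:M.
  have e : t *m a *m x'%:M = t by rewrite -mulmxA [a *m _](proj1 aa') mulmx1.
  have e' : t *m x'%:M + t *m adjmx t *m t *m x'%:M = t.
    by move: e; rewrite /a mulmxDr mulmxDl mulmx1 !mulmxA.
  have e2 : (1%:M + t *m adjmx t) *m (t *m x'%:M *m adjmx t) = t *m adjmx t.
    by rewrite mulmxDl mul1mx !mulmxA -mulmxDl e'.
  by rewrite /q mulmxBr mulmx1 e2 addrK.
have qE : q = 1%:M - t *m x'%:M *m adjmx t by []; move: q qs qV qE => q qs qV qE.
have -> : 1%:M + adjmx U *m U - adjmx U *m t *m x'%:M *m (adjmx t *m U) =
    1 + adjmx (col_mx (q *m U) (adjmx t *m q *m U)) *m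
          col_mx (q *m U) (adjmx t *m q *m U).
  rewrite adjmx_col_mx mul_row_col !adjmxM adjmxK qs -addrA; congr (_ + _).
  have -> : adjmx U *m q *m (q *m U) + adjmx U *m (q *m t) *m (adjmx t *m q *m U) =
      adjmx U *m (q *m ((1%:M + t *m adjmx t) *m q)) *m U.
    by rewrite mulmxDl mul1mx !mulmxDr mulmxDl !mulmxA.
  by rewrite qV mulmx1 qE mulmxBr mulmx1 mulmxBl !mulmxA.
exact: IH.
Qed.

Lemma star_symmetric_mx n : star_symmetric 'M[A]_n.
Proof.
move=> T; apply: gram_mx_invertible; exists n, T.
by rewrite adjmxE.
Qed.

End SymmetricMatrices.

(** * Inverse closedness *)

Section SmallEntries.
Variables (R : realType) (A : starRingType) (S : banach_ring R A).
Hypothesis starS : star_scalars (scal S).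
Hypothesis symA : star_symmetric A.
Variable n : nat.
Local Notation sc := (scal S).
Local Notation scM := (scal (matrix_banach_ring S n)).

Lemma scal_mx_scale k (X : 'M[A]_n) : scM k * X = sc k *: X.
Proof. exact: mul_scalar_mx. Qed.

Lemma gram_mx_scale (r : R) (X : 'M[A]_n) :
  0 < r -> gram_mx X -> invertible (scM r%:C%C + X).
Proof.
move=> r0 [m [T XE]]; pose a := Num.sqrt r.
have a0 : a != 0 by rewrite gt_eqF ?sqrtr_gt0.
have aa : a * a = r by rewrite -expr2 sqr_sqrtr // ltW.
have rC0 : (r%:C)%C != 0 :> R[i] by apply/eqP => /(@complexI R)/eqP; rewrite gt_eqF.
have -> : scM r%:C%C + X =
    scM r%:C%C * (1 + adjmx (sc (a^-1)%:C%C *: T) *m (sc (a^-1)%:C%C *: T)).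
  rewrite mulrDr mulr1; congr (_ + _); rewrite scal_mx_scale XE.
  apply/matrixP => i j; rewrite !mxE mulr_sumr; apply: eq_bigr => k _; rewrite !mxE.
  rewrite star_scal_real //.
  rewrite -mulrA (mulrA (star _)) -(scal_comm S _ (star _)) !mulrA -!rmorphM.
  by rewrite -aa mulfK // divff // !rmorph1 mul1r.
apply: invertibleM; first exact: invertible_field.
by apply: gram_mx_invertible starS symA _ _ _; exists m; eexists.
Qed.

Lemma mul_delta_row (a b : A) (i j : 'I_n) :
  adjmx (a *: delta_mx 0 i : 'rV_n) *m (b *: delta_mx 0 j : 'rV_n) =
  (star a * b) *: delta_mx i j.
Proof.
apply/matrixP => k l; rewrite !mxE big_ord1 !mxE eqxx /=.
by case: (k == i); case: (l == j); rewrite ?mulr1 ?mulr0 ?star0 ?mul0r.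
Qed.

(** For [s_ij ^ 2 = e ^ 2 - h_ij^* h_ij], the matrix [2 e (n e - H)] is the sum over
    [i, j] of the squares [r^* r] of the rows [e d_i - h_ij d_j] and [s_ij d_j],
    where [d] is the standard basis.  Adding the positive scalar
    [2 e (1 - n e)] gives [2 e (1 - H)]. *)
Lemma invertible_sub1_small (H : 'M[A]_n) (e : R) : star H = H ->
    0 < e -> n%:R * e < 1 ->
    (forall i j, exists2 s, star s = s &
       s * s = sc (e * e)%:C%C - star (H i j) * H i j) ->
  invertible (1 - H).
Proof.
move=> Hs e0 ne1 small.
pose E i j : 'M[A]_n := delta_mx i j.
pose X i j := sc (e * e)%:C%C *: E i i - sc e%:C%C *: (H i j *: E i j)
  - sc e%:C%C *: (star (H i j) *: E j i) + sc (e * e)%:C%C *: E j j.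
have gX i j : gram_mx (X i j).
  have [s ss s2] := small i j.
  pose r : 'rV[A]_n := sc e%:C%C *: delta_mx 0 i - H i j *: delta_mx 0 j.
  have -> : X i j = adjmx r *m r +
      adjmx (s *: delta_mx 0 j : 'rV_n) *m (s *: delta_mx 0 j : 'rV_n).
    rewrite mul_delta_row ss s2 /r adjmxB mulmxBl !mulmxBr !mul_delta_row.
    rewrite star_real // -(scal_comm S _ (star _)) -!rmorphM scalerBl /X !scalerA.
    rewrite [in RHS]opprB [RHS]addrACA [X in _ = _ + X]addrAC subrr add0r.
    by rewrite [RHS]addrAC.
  by apply: gram_mxD; [exists 1, r | exists 1; eexists].
have sumE : \sum_i E i i = 1 by rewrite -mx1_sum_delta.
have sumH : \sum_i \sum_j H i j *: E i j = H by rewrite -matrix_sum_delta.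
have sumHs : \sum_i \sum_j star (H i j) *: E j i = H.
  rewrite exchange_big -[RHS]sumH; apply: eq_bigr => i _; apply: eq_bigr => j _ /=.
  by rewrite -[in RHS]Hs mxE.
have sumX : \sum_i \sum_j X i j = scM (2 * n%:R * (e * e))%:C%C - scM (2 * e)%:C%C * H.
  have -> : \sum_i \sum_j X i j = sc (e * e)%:C%C *: ((1 : 'M[A]_n) *+ n) - sc e%:C%C *: H
      - sc e%:C%C *: H + sc (e * e)%:C%C *: ((1 : 'M[A]_n) *+ n).
    under eq_bigr => i _ do
      rewrite big_split !sumrB /= -!scaler_sumr sumr_const card_ord.
    rewrite big_split !sumrB /= -!scaler_sumr sumrMnl sumE sumH sumHs.
    by rewrite sumr_const card_ord.
  have -> : sc (e * e)%:C%C *: ((1 : 'M[A]_n) *+ n) = scM (e * e * n%:R)%:C%C.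
    by rewrite -scal_mx_scale [in RHS]rmorphM [in RHS]rmorphM !rmorph_nat.
  have -> : 2 * n%:R * (e * e) = e * e * n%:R + e * e * n%:R by ring.
  have -> : 2 * e = e + e by ring.
  rewrite -scal_mx_scale !rmorphD mulrDl opprD.
  by rewrite [RHS]addrA addrAC [in LHS](addrAC (scM _)).
have -> : 1 - H = scM ((2 * e)^-1)%:C%C *
    (scM (2 * e * (1 - n%:R * e))%:C%C + \sum_i \sum_j X i j).
  rewrite sumX addrA -!rmorphD.
  have -> : 2 * e * (1 - n%:R * e) + 2 * n%:R * (e * e) = 2 * e by ring.
  rewrite -{1}[scM (2 * e)%:C%C]mulr1 -mulrBr mulrA -!rmorphM.
  by rewrite mulVf ?mulf_neq0 ?gt_eqF // !rmorph1 mul1r.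
apply: invertibleM.
  apply: invertible_field; apply/eqP => /(@complexI R)/eqP.
  by rewrite invr_eq0 gt_eqF ?mulr_gt0.
apply: gram_mx_scale; first by rewrite !mulr_gt0 ?subr_gt0.
by apply: gram_mx_sum => i; apply: gram_mx_sum.
Qed.

End SmallEntries.

Section FromBanachAlgebra.
Variables (R : realType) (B : banachAlgType R[i]).
Implicit Types x y : B.

Lemma anorm_ge0 x : 0 <= anorm x.
Proof. exact: (@normr_ge0 _ (normed_space B) x). Qed.

Definition rnorm x : R := complex.Re (anorm x).

Lemma rnormE x : anorm x = (rnorm x)%:C%C.
Proof. by rewrite /rnorm RRe_real // ger0_real ?anorm_ge0. Qed.

Lemma rnorm_ge0 x : 0 <= rnorm x.
Proof. by rewrite -lecR -rnormE anorm_ge0. Qed.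

Lemma rnorm0_eq0 x : rnorm x = 0 -> x = 0.
Proof. by move=> x0; apply: anorm0_eq0; rewrite rnormE x0. Qed.

Lemma rnorm0 : rnorm (0 : B) = 0.
Proof.
apply: (@complexI R); rewrite -rnormE rmorph0.
exact: (@normr0 _ (normed_space B)).
Qed.

Lemma rnormD x y : rnorm (x + y) <= rnorm x + rnorm y.
Proof. by have := anormD x y; rewrite !rnormE -rmorphD lecR. Qed.

Lemma rnormM x y : rnorm (x * y) <= rnorm x * rnorm y.
Proof. by have := anormM x y; rewrite !rnormE -rmorphM lecR. Qed.

Lemma in_alg_comm (k : R[i]) x : in_alg B k * x = x * in_alg B k.
Proof. by rewrite /= -scalerAl -scalerAr mul1r mulr1. Qed.

Lemma rnormZ (k : R[i]) x : rnorm (in_alg B k * x) = normc k * rnorm x.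
Proof.
rewrite /= -scalerAl mul1r; apply: (@complexI R); rewrite -rnormE anormZ.
by rewrite rnormE rmorphM.
Qed.

Lemma rnorm_complete (f : nat -> B) (C q : R) : 0 <= q < 1 ->
    (forall m, rnorm (f m.+1 - f m) <= C * q ^+ m) ->
  exists l C', forall m, rnorm (l - f m) <= C' * q ^+ m.
Proof.
move=> q01 H; have /andP[q0 q1] := q01.
pose C' := C / (1 - q).
have C0 : 0 <= C by have := H 0; rewrite expr0 mulr1; apply: le_trans; exact: rnorm_ge0.
have C'0 : 0 <= C' by rewrite divr_ge0 //; lra.
have CC' : C = C' * (1 - q) by rewrite divfK //; lra.
have tail m p : rnorm (f (m + p)%N - f m) <= C' * q ^+ m.
  suff : rnorm (f (m + p)%N - f m) <= C' * q ^+ m - C' * q ^+ (m + p).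
    have : 0 <= C' * q ^+ (m + p) by rewrite mulr_ge0 ?exprn_ge0.
    lra.
  elim: p => [|p IH]; first by rewrite addn0 !subrr rnorm0.
  have -> : f (m + p.+1)%N - f m = (f (m + p).+1 - f (m + p)%N) + (f (m + p)%N - f m).
    by rewrite addnS addrA subrK.
  apply: le_trans (rnormD _ _) _; have := H (m + p)%N.
  by rewrite addnS exprS; move: IH; rewrite CC'; set a := q ^+ (m + p); nra.
pose g : nat -> normed_space B := f.
have cg : cauchy (g @ \oo).
  apply/cauchy_ballP => e e0; have eR : e = (complex.Re e)%:C%C.
    by rewrite RRe_real // gtr0_real.
  move: e0; rewrite eR (ltcR 0) => e0; set r := complex.Re e in e0 *.
  have Cp : 0 < 2 * C' + 1 by lra.
  have [N HN] := expr_small q01 (divr_gt0 e0 Cp).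
  have near_gN m : (N <= m)%N -> ball (g N) (r%:C%C / 2) (g m).
    move=> Nm; rewrite -ball_normE /= distrC -[`|_|]/(anorm (f m - f N)) rnormE.
    have -> : (r%:C)%C / 2 = (r / 2)%:C%C by rewrite rmorphM fmorphV rmorph_nat.
    rewrite ltcR; have := tail N (m - N)%N; rewrite subnKC // => h.
    by have := HN N (leqnn N); rewrite ltr_pdivlMr // => h'; have := exprn_ge0 N q0; lra.
  exists ([set x | ball (g N) (r%:C%C / 2) x], [set x | ball (g N) (r%:C%C / 2) x]).
    by split; exists N.
  by move=> [x y] [/= hx hy]; exact: ball_splitr hx hy.
have /cvg_ex[l gl] : cvg (g @ \oo) by apply/cauchy_cvgP.
exists l, C' => m; rewrite -subr_le0; apply/ler_addgt0Pr => e e0; rewrite add0r lerBlDl.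
move/cvgrPdist_le: gl => /(_ e%:C%C); rewrite (ltcR 0) => /(_ e0)[N _ HN].
have := HN (maxn N m) (leq_maxl _ _); rewrite /= -[`|_|]/(anorm (l - f (maxn N m))).
rewrite rnormE lecR => h1.
have := tail m (maxn N m - m)%N; rewrite subnKC ?leq_maxr // => h2.
have -> : l - f m = (l - f (maxn N m)) + (f (maxn N m) - f m) by rewrite addrA subrK.
have := rnormD (l - f (maxn N m)) (f (maxn N m) - f m); lra.
Qed.

Definition banach_ring_of : banach_ring R B :=
  BanachRing in_alg_comm rnorm_ge0 rnorm0_eq0 rnormD rnormM rnormZ rnorm_complete.

End FromBanachAlgebra.

Lemma star_scalars_banach (R : realType) (A : banachStarAlgType R[i]) :
  star_scalars (scal (banach_ring_of A)).
Proof.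
split=> k; first exact: (scal_comm (banach_ring_of A)).
by rewrite /= starZ star1.
Qed.

Lemma starX (A : starRingType) (x : A) n : star (x ^+ n) = star x ^+ n.
Proof.
elim: n => [|n IH]; first by rewrite !expr0 star1.
by rewrite exprS starM IH exprSr.
Qed.

Section InverseClosed.
Variables (R : realType) (A : banachStarAlgType R[i]) (B : banachAlgType R[i]).
Variable iota : {lrmorphism A -> B}.
Hypothesis iota_inj : injective iota.
Hypothesis symA : star_symmetric A.
Hypothesis closedA : star_inverse_closed iota.
Local Notation SA := (banach_ring_of A).
Local Notation SB := (banach_ring_of B).

Lemma iota_scal k : iota (scal SA k) = scal SB k.
Proof. by rewrite /= linearZ rmorph1. Qed.

Lemma star_inverse_closed_invertible (c : A) :
  star c = c -> invertible (iota c) -> invertible c.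
Proof.
move=> cs [d cd]; have [c' c'd] := closedA cs cd; exists c'.
by move: cd; rewrite -c'd; case=> [h1 h2]; split; apply: iota_inj;
  rewrite rmorphM rmorph1.
Qed.

(** No [r > nrm (iota h)] is in the spectrum of [h] in [B]; as [h - r] is
    self-adjoint, [r] is not in that in [A] either. *)
Lemma sqrt_scal_sub (h : A) (e : R) : star h = h -> nrm SB (iota h) < e ->
  exists2 s, star s = s & s * s = scal SA e%:C%C - h.
Proof.
move=> hs he; have scA := star_scalars_banach A.
have shift (r : R) : star (scal SA r%:C%C - h) = scal SA r%:C%C - h.
  by rewrite starB star_real ?hs.
apply: (sqrt_positive scA symA) => // r r0.
have -> : scal SA e%:C%C - h - scal SA r%:C%C = scal SA (e - r)%:C%C - h.
  by rewrite addrAC -!rmorphB.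
apply: star_inverse_closed_invertible => //.
have -> : iota (scal SA (e - r)%:C%C - h) = scal SB (e - r)%:C%C - iota h.
  by rewrite -iota_scal rmorphB.
apply: neumann_scal; rewrite normc_real.
by apply: lt_le_trans he _; apply: le_trans (ler_norm _); lra.
Qed.

(** The spectrum of [c ^ 2] in [M_n(B)] is positive, so that the powers of
    [K = 1 - c ^ 2 / e] tend to [0] there.  By [sqrt_scal_sub], smallness in [B] of
    the entries of a power is what [invertible_sub1_small] requires of them. *)
Lemma map_mx_invertible n (c : 'M[A]_n) :
  star c = c -> invertible (map_mx iota c : 'M[B]_n) -> invertible c.
Proof.
move=> cs inv_c; have scA := star_scalars_banach A.
pose f : {rmorphism 'M[A]_n -> 'M[B]_n} := map_mx iota.
pose SAn := matrix_banach_ring SA n; pose SBn := matrix_banach_ring SB n.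
have f_scal k : f (scal SAn k) = scal SBn k.
  by rewrite /f /= map_scalar_mx /= linearZ rmorph1.
have symAn : star_symmetric 'M[A]_n by exact: star_symmetric_mx scA symA n.
have scAn : star_scalars (scal SAn) by exact: star_scalars_mx.
pose q := c * c.
have qs : star q = q by rewrite starM cs.
pose e : R := nrm SBn (f q) + 1.
have e0 : 0 < e by rewrite /e; have := nrm_ge0 SBn (f q); lra.
pose K := 1 - scal SAn (e^-1)%:C%C * q.
have Ks : star K = K by rewrite starB star1 star_scal_real ?qs.
have gK : geometric_powers SBn (f K).
  rewrite rmorphB rmorph1 rmorphM f_scal; apply: spectrum_gt0_geometric_powers.
  - by rewrite /e; lra.
  - move=> k k0; rewrite -f_scal -rmorphB; apply: invertible_morph.
    exact: self_adjoint_nonreal_invertible scAn _ _ symAn qs k0.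
  - move=> r; rewrite le_eqVlt => /orP[/eqP ->|r0].
      by rewrite !rmorph0 subr0 rmorphM; exact: invertibleM.
    rewrite -f_scal -rmorphB; apply: invertible_morph.
    rewrite addrC -rmorphN -rmorphN; apply: gram_mx_scale => //.
      by rewrite oppr_gt0.
    by exists n, c; rewrite adjmxE cs.
pose eps : R := n.+1%:R^-1.
have eps0 : 0 < eps by rewrite invr_gt0 ltr0n.
have [N N0 KN] := geometric_powers_small eps0 gK.
have small i j : nrm SB (iota ((K ^+ N) i j)) < eps.
  apply: le_lt_trans KN; rewrite -rmorphXn.
  by have := nrm_le_mx SB (f (K ^+ N)) i j; rewrite mxE.
have KNs : star (K ^+ N) = K ^+ N by rewrite starX Ks.
have inv1K : invertible (1 - K).
  apply: (@invertible_sub1_expr _ _ N).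
  apply: (@invertible_sub1_small _ _ SA scA symA n _ eps) => //.
    by rewrite ltr_pdivrMr ?ltr0n // mul1r ltr_nat.
  move=> i j; apply: sqrt_scal_sub; first by rewrite starM starK.
  have hs : star ((K ^+ N) i j) = (K ^+ N) j i by rewrite -[in RHS]KNs mxE.
  rewrite rmorphM hs; apply: le_lt_trans (nrmM _ _ _) _.
  by apply: ltr_pM; [exact: nrm_ge0|exact: nrm_ge0|exact: small|exact: small].
have : invertible (c * (c * scal SAn (e^-1)%:C%C)).
  by rewrite mulrA -scal_comm; move: inv1K; rewrite /K opprB addrC subrK.
apply: invertible_comm_factor; rewrite /GRing.comm -mulrA.
by rewrite scal_comm.
Qed.

End InverseClosed.

Theorem theorem9 (R : realType) (A : banachStarAlgType R[i])
    (B : banachAlgType R[i]) (iota : {lrmorphism A -> B}) (n : nat) :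
  injective iota ->
  star_symmetric A ->
  star_inverse_closed iota ->
  continuously_embedded iota ->
  (1 <= n)%N ->
  star_symmetric 'M[A]_n /\
  star_inverse_closed (map_mx iota : {rmorphism 'M[A]_n -> 'M[B]_n}).
Proof.
move=> iota_inj symA closedA _ _; split.
  exact: star_symmetric_mx (star_scalars_banach A) symA n.
move=> c cs d cd.
have [|c' cc'] := map_mx_invertible iota_inj symA closedA cs; first by exists d.
exists c'; apply: is_inverse_uniq cd.
exact: (is_inverse_morph (map_mx iota : {rmorphism 'M[A]_n -> 'M[B]_n}) cc').
Qed.
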